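(* Let $G_{\mathbb R}$ be a connected simple linear real Lie group with Lie algebra $\mathfrak g_{\mathbb R}$, and let $e\in\mathfrak g_{\mathbb R}$ be a nilpotent element. Then there exist a hyperbolic semisimple element $x_h\in\mathfrak g_{\mathbb R}$ and an elliptic semisimple element $x_e\in\mathfrak g_{\mathbb R}$ such that $$G_{\mathbb R}\cdot e\subset\lim_{\nu\to 0^+}G_{\mathbb R}\cdot(\nu x_h)\quad\text{and}\quad G_{\mathbb R}\cdot e\subset\lim_{\nu\to 0^+}G_{\mathbb R}\cdot(\nu x_e).$$
   Context: The dot denotes the adjoint action. An element $x\in\mathfrak g_{\mathbb R}$ is nilpotent if $\mathrm{ad}(x)$ is nilpotent, and semisimple if $\mathrm{ad}(x)$ is diagonalizable over $\mathbb C$; a semisimple $x$ is hyperbolic (resp. elliptic) if all eigenvalues of $\mathrm{ad}(x)$ are real (resp. purely imaginary). For $x\in\mathfrak g_{\mathbb R}$, $$\lim_{\nu\to 0^+}G_{\mathbb R}\cdot(\nu x):=\bigcap_{\epsilon>0}\overline{\bigcup_{\nu\in(0,\epsilon)}G_{\mathbb R}\cdot(\nu x)},$$ with closures taken in the Euclidean topology of $\mathfrak g_{\mathbb R}$. *)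

(* Defs.v *)
From HB Require Import structures.
From mathcomp Require Import all_boot all_order all_algebra.
From mathcomp Require Import complex.
From mathcomp Require Import all_classical all_reals all_analysis.
Set Implicit Arguments.
Unset Strict Implicit.
Unset Printing Implicit Defensive.
Import Order.TTheory GRing.Theory Num.Theory.
Import numFieldNormedType.Exports.

Local Open Scope classical_set_scope.
Local Open Scope ring_scope.

Definition expmx (R : realType) (n : nat) (X : 'M[R]_n) : 'M[R]_n :=
  limn (series (fun k => (k`!%:R)^-1 *: X ^+ k)).

Definition bracket (R : realType) (n : nat) (x y : 'M[R]_n) : 'M[R]_n :=
  x *m y - y *m x.

Definition Ad (R : realType) (n : nat) (h x : 'M[R]_n) : 'M[R]_n :=
  h *m x *m invmx h.

(* A linear Lie group is a closed subgroup of GL_n(R). Closedness is relative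
   to the open subset GL_n(R) of 'M[R]_n, so that sequences in G converging to
   a singular matrix are allowed. *)
Record linear_lie_group (R : realType) (n : nat) (G : set 'M[R]_n) : Prop :=
  LinearLieGroup {
    llg_unit : forall h, G h -> h \in unitmx;
    llg_one : G 1%:M;
    llg_mul : forall h k, G h -> G k -> G (h *m k);
    llg_inv : forall h, G h -> G (invmx h);
    llg_closed : forall h, closure G h -> h \in unitmx -> G h
  }.

Definition is_lie_algebra_of (R : realType) (n : nat)
    (g : {vspace 'M[R]_n}) (G : set 'M[R]_n) : Prop :=
  forall X : 'M[R]_n, X \in g <-> forall t : R, G (expmx (t *: X)).

Definition lie_subalgebra (R : realType) (n : nat) (g : {vspace 'M[R]_n}) :
    Prop :=
  forall x y, x \in g -> y \in g -> bracket x y \in g.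

Definition lie_ideal (R : realType) (n : nat) (g I : {vspace 'M[R]_n}) : Prop :=
  (I <= g)%VS /\ forall x y, x \in g -> y \in I -> bracket x y \in I.

Record simple_lie_algebra (R : realType) (n : nat) (g : {vspace 'M[R]_n}) :
    Prop := SimpleLieAlgebra {
  sla_bracket : lie_subalgebra g;
  sla_nonabelian : exists x y, [/\ x \in g, y \in g & bracket x y != 0];
  sla_ideal : forall I : {vspace 'M[R]_n}, lie_ideal g I -> I = 0%VS \/ I = g
}.

(* A connected Lie group is simple when its Lie algebra is; in particular its
   centre may be a nontrivial discrete subgroup. *)
Definition connected_simple_linear_lie_group (R : realType) (n : nat)
    (G : set 'M[R]_n) (g : {vspace 'M[R]_n}) : Prop :=
  [/\ linear_lie_group G, connected G, is_lie_algebra_of g G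
    & simple_lie_algebra g].

(* The matrix of ad(x) : g -> g in the basis (vbasis g), acting on row vectors:
   row i holds the coordinates of the bracket of x with the i-th basis vector.
   It is only meaningful when g is a Lie subalgebra containing x. *)
Definition ad_mx (R : realType) (n : nat) (g : {vspace 'M[R]_n})
    (x : 'M[R]_n) : 'M[R]_(\dim g) :=
  \matrix_(i, j) coord (vbasis g) j (bracket x (vbasis g)`_i).

Definition ad_mxC (R : realType) (n : nat) (g : {vspace 'M[R]_n})
    (x : 'M[R]_n) : 'M[R[i]]_(\dim g) :=
  map_mx (real_complex R) (ad_mx g x).

Definition nilpotent_elt (R : realType) (n : nat) (g : {vspace 'M[R]_n})
    (x : 'M[R]_n) : Prop :=
  x \in g /\ exists k : nat, ad_mx g x ^+ k = 0.

Definition semisimple_elt (R : realType) (n : nat) (g : {vspace 'M[R]_n})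
    (x : 'M[R]_n) : Prop :=
  x \in g /\ diagonalizable (ad_mxC g x).

Definition hyperbolic_elt (R : realType) (n : nat) (g : {vspace 'M[R]_n})
    (x : 'M[R]_n) : Prop :=
  semisimple_elt g x /\
  forall a : R[i], eigenvalue (ad_mxC g x) a -> complex.Im a = 0.

Definition elliptic_elt (R : realType) (n : nat) (g : {vspace 'M[R]_n})
    (x : 'M[R]_n) : Prop :=
  semisimple_elt g x /\
  forall a : R[i], eigenvalue (ad_mxC g x) a -> complex.Re a = 0.

Definition adjoint_orbit (R : realType) (n : nat) (G : set 'M[R]_n)
    (x : 'M[R]_n) : set 'M[R]_n :=
  [set Ad h x | h in G].

(* The Euclidean topology of g is the one induced by 'M[R]_n, hence the closure
   in g is the trace on g of the closure in 'M[R]_n. *)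
Definition closure_in (R : realType) (n : nat) (g : {vspace 'M[R]_n})
    (A : set 'M[R]_n) : set 'M[R]_n :=
  [set` g] `&` closure A.

Definition limit_orbits (R : realType) (n : nat) (G : set 'M[R]_n)
    (g : {vspace 'M[R]_n}) (x : 'M[R]_n) : set 'M[R]_n :=
  \bigcap_(eps in [set eps : R | 0 < eps])
    closure_in g
      (\bigcup_(nu in [set nu : R | 0 < nu < eps]) adjoint_orbit G (nu *: x)).

(* Main.v *)
Require Import Defs.
From HB Require Import structures.
From mathcomp Require Import all_boot all_order all_algebra.
From mathcomp Require Import complex.
From mathcomp Require Import ring lra zify.
From mathcomp Require Import all_classical all_reals all_analysis.
Import Order.TTheory GRing.Theory Num.Theory.
Import numFieldNormedType.Exports.

Local Open Scope classical_set_scope.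
Local Open Scope ring_scope.

(** The Jacobson-Morozov theorem provides h and f in g with [h, e] = 2e,
    [h, f] = -2f and [e, f] = h (all zero when e = 0).  The elements x_h = h and
    x_e = e - f have the required property, for a reason that takes place in the
    one-parameter group exp (s e).  Since ad e is nilpotent on the span of
    e, h, f,
      Ad (exp (s e)) h       = h - 2 s e,
      Ad (exp (s e)) (e - f) = (1 + s^2) e - f - s h.
    Rescaling the first by nu = -1 / (2 s) and the second by nu = 1 / s^2 gives
    curves that tend to e as nu tends to 0 (Ad_expmx, limit_orbits_of_curve).
    As Ad k is linear and continuous, the same curves moved by k in G reach every
    point of the orbit of e.  The relation [h, e] = 2e makes e nilpotent as a
    matrix (ladder_nilpotent), so that only finite exponential sums occur.

    In any finite-dimensional representation of sl2 the operator H is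
    diagonalizable with integer eigenvalues (sl2_semisimple).  Instead of complete
    reducibility, the proof uses the Casimir operator plus 1, called D: products of
    the factors D - (H - 2i - 1)^2 are multiples of E^k F^k and products of the
    factors D - (H + 2j + 1)^2 are multiples of F^k E^k, so both vanish for large
    k, and the ideal generated by two such products contains a product of distinct
    factors H - a, with a an integer.  Applied to ad h this says that h is
    hyperbolic; over the complex numbers i (e - f) is the middle element of
    another sl2-triple (cayley_triple), so e - f is elliptic.

    The Jacobson-Morozov theorem rests on the nondegeneracy of the Killing form.
    An element z with (ad e)^2 z = 0 is orthogonal to e, because ad e ad z then
    has trace 0 (nilpotent_trace); by duality e lies in the image of (ad e)^2,
    which produces h, and Morozov's argument (morozov_shift_onto) produces f.  If
    the Killing form were degenerate it would vanish, its radical being an ideal.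
    For x in g let D be the operator that multiplies the generalized eigenspace of
    ad x for a by the conjugate of a.  It is a derivation of the complexified
    algebra, because conjugation is additive, so the trace of (ad x) D, which is
    the sum of |a|^2 over the eigenvalues, vanishes
    (ad_nilpotent_of_killing_eq0).  Then every ad x is nilpotent, and Engel's
    theorem gives a nonzero central element, which a simple algebra does not
    have.

    Row vectors hold coordinates and matrices act on the right, so that x |-> ad x
    reverses commutators of matrices; this is why the triple attached to (e, f, h)
    is (ad f, ad e, ad h). *)

(** * Ladder operators are nilpotent *)

(** Taking the commutator with H is a derivation and sends E to 2E. *)
Lemma derivation_horner (F : numFieldType) (n : nat) (E H : 'M[F]_n.+1)
    (q : {poly F}) :
  H * E - E * H = E *+ 2 ->
  H * horner_mx E q - horner_mx E q * H = (E * horner_mx E q^`()) *+ 2.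
Proof.
move=> HE; elim/poly_ind: q => [|q c IHq].
  by rewrite deriv0 !raddf0 mulr0 mul0r subr0 mulr0 mul0rn.
rewrite derivMXaddC rmorphD rmorphM /= horner_mx_X horner_mx_C.
rewrite rmorphD rmorphM /= horner_mx_X.
have cH : H * c%:M = c%:M * H by exact: comm_mx_scalar.
rewrite mulrDr mulrDl opprD addrACA cH subrr addr0.
set Q := horner_mx E q in IHq *; set Q' := horner_mx E q^`() in IHq *.
have cEQ : E * Q = Q * E by exact: comm_mx_horner.
have cEQ' : E * Q' = Q' * E by exact: comm_mx_horner.
transitivity ((H * Q - Q * H) * E + Q * (H * E - E * H)).
  by rewrite mulrBl mulrBr !mulrA addrA subrK.
by rewrite IHq HE mulrnAl mulrnAr -mulrnDl mulrDr cEQ mulrA addrC.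
Qed.

(** The minimal polynomial p of E satisfies E p'(E) = 0, by taking the
    commutator of H with p(E) = 0.  Thus p divides X p', and comparing degrees
    and coefficients leaves only p = X^d. *)
Lemma ladder_nilpotent (F : numFieldType) (n : nat) (E H : 'M[F]_n.+1) :
  H * E - E * H = E *+ 2 -> exists k, E ^+ k = 0.
Proof.
move=> HE; set p := mxminpoly E; set d := (size p).-1.
have p_dvd : p %| 'X * p^`().
  rewrite dvd_mxminpoly rmorphM /= horner_mx_X.
  have := derivation_horner _ _ _ _ p HE.
  rewrite mx_root_minpoly mulr0 mul0r subrr => /esym/eqP.
  by rewrite -scaler_nat scaler_eq0 pnatr_eq0.
pose q := 'X * p^`() - d%:R *: p.
have qi i : q`_i = (i%:R - d%:R) * p`_i.
  rewrite coefB coefXM coefZ coef_deriv.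
  by case: i => [|i] /=; rewrite ?mul0r; [ring | rewrite -mulr_natr; ring].
have p0 : p != 0 by rewrite monic_neq0 // mxminpoly_monic.
have q0 : q = 0.
  apply/eqP; apply: contraTT isT => qn0.
  have : (size p <= size q)%N.
    by apply: dvdp_leq => //; apply: dvdp_sub => //; rewrite -mul_polyC dvdp_mulIr.
  rewrite leqNgt => /negP[].
  rewrite -(prednK (n := size p)) ?size_poly_gt0 // ltnS; apply/leq_sizeP => i.
  rewrite leq_eqVlt qi => /orP[/eqP<-|di]; first by rewrite subrr mul0r.
  by rewrite nth_default ?mulr0 // -(prednK (n := size p)) ?size_poly_gt0.
exists d; have <- : horner_mx E p = E ^+ d; last exact: mx_root_minpoly.
have -> : p = 'X^d.
  apply/polyP => i; rewrite coefXn; case: eqP => [->|/eqP id].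
    by have := mxminpoly_monic E; rewrite monicE => /eqP.
  have /eqP := qi i; rewrite q0 coef0 eq_sym mulf_eq0 subr_eq0 eqr_nat.
  by rewrite (negPf id) => /eqP.
by rewrite rmorphXn /= horner_mx_X.
Qed.

Lemma ladder_nilpotent_mx (F : numFieldType) (n : nat) (E H : 'M[F]_n) :
  H *m E - E *m H = E *+ 2 -> exists k, E ^+ k = 0.
Proof.
case: n E H => [|n] E H HE; first by exists 0%N; rewrite [LHS]thinmx0 [RHS]thinmx0.
exact: (ladder_nilpotent _ _ E H HE).
Qed.

(** * Weights of a pair of commuting operators *)

Section WeightIdeal.
Variables (K : comNzRingType) (D H : K).

(** Ideals that are stable under cancellation of nonzero integers: the
    kernel of a ring morphism to matrices in characteristic 0 is of this kind, and
    so are its colon ideals, which is what the inductions below need. *)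
Definition torsion_free_ideal (I : K -> Prop) : Prop :=
  [/\ forall p q, I p -> I q -> I (p + q),
      forall c p, I p -> I (c * p)
    & forall (z : int) p, z != 0 -> I (z%:~R * p) -> I p].

(** When D is the Casimir operator plus 1, index 0 gives 4EF and 4FE; index k
    arises by moving them past E^k, respectively F^k. *)
Definition hw_factor (i : nat) : K := D - (H - (2 * i + 1)%:R) ^+ 2.
Definition lw_factor (j : nat) : K := D - (H + (2 * j + 1)%:R) ^+ 2.
Definition root_prod (t : seq int) : K := \prod_(a <- t) (H - a%:~R).

Lemma colon_ideal (I : K -> Prop) (c : K) :
  torsion_free_ideal I -> torsion_free_ideal (fun p => I (c * p)).
Proof.
case=> Iadd Imul Icancel; split=> [p q Ip Iq|d p Ip|z p z0 Ip].
- by rewrite mulrDr; apply: Iadd.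
- by rewrite mulrCA; apply: Imul.
- by apply: (Icancel z) => //; rewrite mulrCA.
Qed.

Lemma ideal_comb (I : K -> Prop) (p q c d r : K) :
  torsion_free_ideal I -> I p -> I q -> r = c * p + d * q -> I r.
Proof. by case=> Iadd Imul _ Ip Iq ->; apply: Iadd; apply: Imul. Qed.

Lemma ideal_cancel (I : K -> Prop) (z : int) (p q c d r : K) :
  torsion_free_ideal I -> z != 0 -> I p -> I q ->
  z%:~R * r = c * p + d * q -> I r.
Proof.
move=> idI z0 Ip Iq e; have [_ _ Ic] := idI.
by apply: (Ic z) => //; apply: ideal_comb e.
Qed.

(** If m is not in t, the product over t is a nonzero integer modulo H - m. *)
Lemma nonroot_cancel (I : K -> Prop) (m : int) (t : seq int) (c : K) :
  torsion_free_ideal I -> m \notin t ->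
  I (c * (H - m%:~R)) -> I (c * root_prod t) -> I c.
Proof.
move=> idI; elim: t c => [|a t IHt] c.
  by rewrite /root_prod big_nil mulr1.
rewrite inE negb_or => /andP[ma mt] Im.
rewrite /root_prod big_cons mulrA => /IHt-/(_ mt) Ia.
have {}Ia : I (c * (H - a%:~R)).
  by apply: Ia; rewrite mulrAC mulrC; case: idI => _ Imul _; apply: Imul.
apply: (@ideal_cancel I (m - a) _ _ 1 (-1) c idI _ Ia Im).
  by rewrite subr_eq0.
by rewrite rmorphB /=; ring.
Qed.

Lemma double_root_cancel (I : K -> Prop) (m : int) (t : seq int) :
  torsion_free_ideal I -> uniq t -> I (root_prod t) ->
  I ((H - m%:~R) ^+ 2) -> I (H - m%:~R).
Proof.
elim: t I => [|a t IHt] I idI.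
  rewrite /root_prod big_nil => _ I1 _; case: idI => _ Imul _.
  by rewrite -[_ - _]mulr1; apply: Imul.
rewrite /= => /andP[at_ ut]; rewrite /root_prod big_cons => Ip Im2.
have [am|am] := eqVneq a m.
  subst a; apply: (@nonroot_cancel _ m t) => //.
have Iam : I ((H - a%:~R) * (H - m%:~R)).
  apply: (IHt _ (@colon_ideal I (H - a%:~R) idI)) => //.
  by case: idI => _ Imul _; apply: Imul.
apply: (@ideal_cancel I (a - m) _ _ 1 (-1) _ idI _ Im2 Iam).
  by rewrite subr_eq0.
by rewrite rmorphB /=; ring.
Qed.

(** The difference of the two quadratic factors is linear in H: this is what
    makes the weights integers. *)
Lemma lw_hw_factor (i j : nat) :
  lw_factor j = hw_factor i - (4 * (i + j + 1))%:R * (H - (i%:Z - j%:Z)%:~R).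
Proof. by rewrite /lw_factor /hw_factor; ring. Qed.

(** Modulo the factor of index i each factor of index j becomes a nonzero
    multiple of H - (i - j). *)
Lemma lw_prod_mod_hw (I : K -> Prop) (i : nat) (t : seq nat) (c : K) :
  torsion_free_ideal I -> I (c * hw_factor i) ->
  I (c * \prod_(j <- t) lw_factor j) ->
  I (c * root_prod [seq i%:Z - j%:Z | j <- t]).
Proof.
move=> idI; elim: t c => [|j t IHt] c Ix; first by rewrite /root_prod !big_nil.
rewrite /root_prod /= !big_cons mulrA => /IHt Iy.
have {}Iy : I (c * lw_factor j * root_prod [seq i%:Z - j%:Z | j <- t]).
  by apply: Iy; rewrite mulrAC mulrC; case: idI => _ Imul _; apply: Imul.
have z0 : (4 * (i + j + 1))%:Z != 0 by lia.
rewrite /root_prod in Iy.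
apply: (@ideal_cancel I _ _ _ (root_prod [seq i%:Z - j%:Z | j <- t]) (-1) _ idI
  z0 Ix Iy).
by rewrite (lw_hw_factor i j) /root_prod -pmulrn; ring.
Qed.

(** Geometrically, the curves D = (H - 2i - 1)^2 and D = (H + 2j + 1)^2 meet
    only at H = i - j, and different pairs (i, j) with the same difference give
    different values of D, so the intersection is reduced in the direction of H.
    The induction on s replaces the ideal by its colon ideals by two of the
    factors; both factors then lie in the colon ideal by H - m, and their
    difference is there a nonzero integer when m = i - j.  For the other m,
    lw_prod_mod_hw and nonroot_cancel suffice. *)
Lemma weight_double_root_cancel (I : K -> Prop) (m : int) (s t : seq nat) :
  torsion_free_ideal I -> uniq s -> uniq t ->
  I (\prod_(i <- s) hw_factor i) -> I (\prod_(j <- t) lw_factor j) ->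
  I ((H - m%:~R) ^+ 2) -> I (H - m%:~R).
Proof.
move=> idI us ut; have [n] := ubnP (size s); elim: n s I idI us => // n IHn.
have ut' i : uniq [seq i%:Z - j%:Z | j <- t].
  by rewrite map_inj_uniq // => a b /eqP; rewrite -subr_eq0 => /eqP e; lia.
move=> [|i [|i' s]] I idI us.
- rewrite big_nil => _ I1 _ _; case: idI => _ Imul _.
  by rewrite -[_ - _]mulr1; apply: Imul.
- rewrite big_seq1 => _ Ix Iy Im.
  apply: (@double_root_cancel I m _ idI (ut' i) _ Im).
  by rewrite -[root_prod _]mul1r; apply: lw_prod_mod_hw; rewrite ?mul1r.
rewrite !big_cons /= => sz Ix Iy Im.
move: us => /= /andP[]; rewrite inE negb_or => /andP[ii' iNs] /andP[i'Ns us].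
have [_ Imul Icancel] := idI.
pose J p := I ((H - m%:~R) * p).
have idJ : torsion_free_ideal J by exact: colon_ideal.
have Ji : J (hw_factor i).
  rewrite /J mulrC; apply: (IHn (i' :: s) (fun p => I (hw_factor i * p)));
    rewrite ?big_cons /= ?i'Ns //.
  - exact: colon_ideal.
  - exact: Imul.
  - exact: Imul.
have Ji' : J (hw_factor i').
  rewrite /J mulrC; apply: (IHn (i :: s) (fun p => I (hw_factor i' * p)));
    rewrite ?big_cons /= ?iNs //.
  - exact: colon_ideal.
  - by rewrite mulrCA.
  - exact: Imul.
  - exact: Imul.
have Jm : J (H - m%:~R) by [].
suff J1 : J 1 by move: J1; rewrite /J mulr1.
have [/mapP[j _ mE]|mN] := boolP (m \in [seq i%:Z - j%:Z | j <- t]); last first.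
  apply: (@nonroot_cancel J m _ 1 idJ mN); rewrite ?mul1r //.
  rewrite -[root_prod _]mul1r; apply: lw_prod_mod_hw; rewrite ?mul1r //.
  exact: Imul.
(* Modulo H - m the difference of the factors of indices i and i' is the
   integer z, and m = i - j makes its last factor -j - i' - 1 nonzero. *)
pose z := 4 * (i%:Z - i'%:Z) * (m - i%:Z - i'%:Z - 1) : int.
have z0 : z != 0.
  rewrite /z !mulf_neq0 //; first by move: ii' => /eqP; lia.
  by rewrite mE; lia.
have Jd : J (hw_factor i - hw_factor i').
  by apply: (@ideal_comb J _ _ 1 (-1) _ idJ Ji Ji'); ring.
apply: (@ideal_cancel J z _ _ 1 (- (4 * (i%:Z - i'%:Z))%:~R) _ idJ z0 Jd Jm).
by rewrite /z /hw_factor; ring.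
Qed.

(** The possible weights, without control of multiplicities. *)
Lemma weight_prod_ideal (I : K -> Prop) (s t : seq nat) (c : K) :
  torsion_free_ideal I -> I (c * \prod_(i <- s) hw_factor i) ->
  I (\prod_(j <- t) lw_factor j) ->
  I (c * root_prod [seq i%:Z - j%:Z | i <- s, j <- t]).
Proof.
move=> idI; have [_ Imul _] := idI.
elim: s c => [|i s IHs] c; first by rewrite /root_prod !big_nil.
rewrite big_cons mulrA => /IHs{}IHs Iy.
rewrite /= /root_prod big_cat /= -/(root_prod _) -/(root_prod _) mulrCA mulrC.
apply: lw_prod_mod_hw => //; last exact: Imul.
by rewrite mulrAC; apply: IHs.
Qed.

(** The integers i - j bound the weights, and multiplicities drop to 1 one
    factor at a time. *)
Lemma squarefree_weight_poly (I : K -> Prop) (s t : seq nat) :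
  torsion_free_ideal I -> uniq s -> uniq t ->
  I (\prod_(i <- s) hw_factor i) -> I (\prod_(j <- t) lw_factor j) ->
  exists l : seq int, uniq l /\ I (root_prod l).
Proof.
move=> idI us ut Is It; have [_ Imul _] := idI.
have sq m c : I (c * (H - m%:~R) ^+ 2) -> I (c * (H - m%:~R)).
  apply: (@weight_double_root_cancel (fun p => I (c * p)) m s t) => //.
  - exact: colon_ideal.
  - exact: Imul.
  - exact: Imul.
have Il := @weight_prod_ideal I s t 1 idI.
move: Il; set l := (X in root_prod X) => Il.
exists (undup l); split; first exact: undup_uniq.
have {}Il : I (1 * root_prod l) by apply: Il; rewrite ?mul1r.
rewrite -[root_prod _]mul1r; move: (1 : K) Il.
elim: (l) => //= a l' IHl c; rewrite /root_prod big_cons mulrA => /IHl{}IHl.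
case: ifP => al; last by rewrite big_cons mulrA.
have al' : a \in undup l' by rewrite mem_undup.
move: IHl; rewrite /root_prod !(bigD1_seq a al' (undup_uniq _)) /=.
set Q := \prod_(_ <- _ | _) _ => IHl.
rewrite mulrCA mulrC; apply: sq.
by move: IHl; congr I; ring.
Qed.

End WeightIdeal.

Arguments torsion_free_ideal {K} I.
Arguments hw_factor {K} D H i.
Arguments lw_factor {K} D H j.
Arguments root_prod {K} H t.

(** * Semisimplicity in sl2-triples *)

Section Casimir.
Variables (A : pzRingType) (E F H : A).
Hypothesis HE : H * E - E * H = E *+ 2.
Hypothesis HF : H * F - F * H = - (F *+ 2).
Hypothesis EF : E * F - F * E = H.

(** The Casimir element plus 1, normalized so that it equals
    4FE + (H + 1)^2 and 4EF + (H - 1)^2. *)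
Definition casimir : A := (F * E) *+ 4 + (H + 1) ^+ 2.

Lemma HE_swap : H * E = E * (H + 2%:R).
Proof. by rewrite mulrDr mulr_natr -HE addrC subrK. Qed.

Lemma HF_swap : H * F = F * (H - 2%:R).
Proof. by rewrite mulrBr mulr_natr -HF addrC subrK. Qed.

Lemma EF_swap : E * F = F * E + H.
Proof. by rewrite -EF addrC subrK. Qed.

Lemma casimirE : casimir = (E * F) *+ 4 + (H - 1) ^+ 2.
Proof.
rewrite /casimir EF_swap mulrnDl sqrrD1 sqrrB1 -[RHS]addrA; congr (_ + _).
rewrite [RHS]addrA; congr (_ + 1); rewrite [RHS]addrCA; congr (_ + _).
by rewrite -mulrnBr.
Qed.

Lemma shiftE : (H - 1) * E = E * (H + 1).
Proof. by rewrite mulrBl mul1r HE_swap !mulrDr mulr1 addrA addrK. Qed.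

Lemma shiftF : (H + 1) * F = F * (H - 1).
Proof.
rewrite mulrDl mul1r HF_swap !mulrBr mulr1 mulr_natr mulr2n opprD addrA.
by rewrite subrK.
Qed.

Lemma casimir_commE : casimir * E = E * casimir.
Proof.
rewrite {1}casimirE /casimir mulrDl mulrDr mulrnAl mulrnAr !expr2 -!mulrA.
by rewrite shiftE [in LHS](mulrA (H - 1)) shiftE -(mulrA E).
Qed.

Lemma casimir_commF : casimir * F = F * casimir.
Proof.
rewrite {2}casimirE /casimir mulrDl mulrDr mulrnAl mulrnAr !expr2 -!mulrA.
by rewrite shiftF [in LHS](mulrA (H + 1)) shiftF -(mulrA F).
Qed.

Lemma casimir_commH : casimir * H = H * casimir.
Proof.
rewrite -EF mulrBl mulrBr !mulrA casimir_commE casimir_commF.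
by rewrite -!mulrA casimir_commE casimir_commF.
Qed.

Lemma shiftEX k : E ^+ k * (H - 1) = (H - (2 * k + 1)%:R) * E ^+ k.
Proof.
elim: k => [|k IHk]; first by rewrite expr0 mul1r mulr1.
rewrite exprS -mulrA IHk [LHS]mulrA [RHS]mulrA; congr (_ * _).
have -> : (2 * k.+1 + 1 = 2 + (2 * k + 1))%N by lia.
move: (2 * k + 1)%N => c; rewrite mulrBr [RHS]mulrBl HE_swap mulrDr.
by rewrite !mulr_natr mulr_natl mulrnDr opprD addrA addrK.
Qed.

Lemma shiftFX k : F ^+ k * (H + 1) = (H + (2 * k + 1)%:R) * F ^+ k.
Proof.
elim: k => [|k IHk]; first by rewrite expr0 mul1r mulr1.
rewrite exprS -mulrA IHk [LHS]mulrA [RHS]mulrA; congr (_ * _).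
have -> : (2 * k.+1 + 1 = 2 + (2 * k + 1))%N by lia.
move: (2 * k + 1)%N => c; rewrite mulrDr [RHS]mulrDl HF_swap mulrBr.
by rewrite !mulr_natr mulr_natl mulrnDr addrA subrK.
Qed.

Lemma casimir_commX (x : A) k :
  casimir * x = x * casimir -> x ^+ k * casimir = casimir * x ^+ k.
Proof. by move=> cx; apply/commr_sym/commrX. Qed.

(** The factor 4EF in the middle of E^(k+1) F^(k+1) is casimir - (H - 1)^2;
    moving it to the left of E^k shifts H by 2k. *)
Lemma ladder_down k :
  (E ^+ k.+1 * F ^+ k.+1) *+ 4 =
  (casimir - (H - (2 * k + 1)%:R) ^+ 2) * (E ^+ k * F ^+ k).
Proof.
rewrite exprSr exprS !mulrA -[_ * E * F]mulrA -mulrnAl -mulrnAr.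
have -> : (E * F) *+ 4 = casimir - (H - 1) ^+ 2 by rewrite casimirE addrK.
congr (_ * _); rewrite mulrBr mulrBl casimir_commX ?casimir_commE //.
by rewrite !expr2 mulrA shiftEX -mulrA shiftEX !mulrA.
Qed.

Lemma ladder_up k :
  (F ^+ k.+1 * E ^+ k.+1) *+ 4 =
  (casimir - (H + (2 * k + 1)%:R) ^+ 2) * (F ^+ k * E ^+ k).
Proof.
rewrite exprSr exprS !mulrA -[_ * F * E]mulrA -mulrnAl -mulrnAr.
have -> : (F * E) *+ 4 = casimir - (H + 1) ^+ 2 by rewrite /casimir addrK.
congr (_ * _); rewrite mulrBr mulrBl casimir_commX ?casimir_commF //.
by rewrite !expr2 mulrA shiftFX -mulrA shiftFX !mulrA.
Qed.

End Casimir.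

Arguments casimir {A} E F H.

Definition sl2_triple {A : pzRingType} (E F H : A) : Prop :=
  [/\ H * E - E * H = E *+ 2, H * F - F * H = - (F *+ 2) & E * F - F * E = H].

(** Two commuting matrices, the Casimir element and h, define a morphism
    from polynomials in two variables to matrices; its kernel is the ideal to which
    the previous section applies. *)
Lemma sl2_weight_poly (F : numFieldType) (n : nat) (e f h : 'M[F]_n.+1) :
  sl2_triple e f h ->
  exists l : seq int,
    uniq l /\ horner_mx h (\prod_(a <- l) ('X - (a%:~R)%:P)) = 0.
Proof.
case=> he hf ef.
set D := casimir e f h.
have cD : commr_rmorph (horner_mx h) D.
  by move=> q; apply: comm_mx_horner; apply: casimir_commH he hf ef.
pose ev : {rmorphism {poly {poly F}} -> 'M[F]_n.+1} := horner_morph cD.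
have evH : ev 'X%:P = h by rewrite /ev /= horner_morphC /= horner_mx_X.
have evD : ev 'X = D by rewrite /ev /= horner_morphX.
pose I (p : {poly {poly F}}) := ev p = 0.
have idI : torsion_free_ideal I.
  rewrite /I; split=> [p q Ip Iq|c p Ip|z p z0].
  - by rewrite rmorphD /= Ip Iq addr0.
  - by rewrite rmorphM /= Ip mulr0.
  - rewrite rmorphM rmorph_int /= => /eqP.
    by rewrite mulrzl -scaler_int scaler_eq0 intr_eq0 (negPf z0) => /eqP.
have [k ek] := ladder_nilpotent _ _ _ _ he.
have [m fm] : exists m, f ^+ m = 0.
  apply: (ladder_nilpotent _ _ f (- h)).
  by rewrite mulNr mulrN -opprD hf opprK.
have four0 (x : 'M[F]_n.+1) : x *+ 4 = 0 -> x = 0.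
  by move/eqP; rewrite -scaler_nat scaler_eq0 pnatr_eq0 /= => /eqP.
have iotaSr i : iota 0 i.+1 = iota 0 i ++ [:: i] by rewrite -addn1 iotaD.
have hw i : exists c : F, ev (\prod_(j <- iota 0 i) hw_factor 'X 'X%:P j)
     = c *: (e ^+ i * f ^+ i).
  elim: i => [|i [c IHi]]; first by exists 1; rewrite big_nil rmorph1 mulr1 scale1r.
  exists (c * 4); rewrite -scalerA scaler_nat (ladder_down _ _ _ _ he ef) scalerAr -IHi.
  rewrite iotaSr big_cat big_seq1 /= mulrC rmorphM /=.
  by rewrite rmorphB rmorphXn /= rmorphB rmorph_nat /= evH evD.
have lw i : exists c : F, ev (\prod_(j <- iota 0 i) lw_factor 'X 'X%:P j)
     = c *: (f ^+ i * e ^+ i).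
  elim: i => [|i [c IHi]]; first by exists 1; rewrite big_nil rmorph1 mulr1 scale1r.
  exists (c * 4); rewrite -scalerA scaler_nat (ladder_up _ _ _ _ hf ef) scalerAr -IHi.
  rewrite iotaSr big_cat big_seq1 /= mulrC rmorphM /=.
  by rewrite rmorphB rmorphXn /= rmorphD rmorph_nat /= evH evD.
have [l [ul Il]] : exists l, uniq l /\ I (root_prod 'X%:P l).
  apply: (squarefree_weight_poly _ 'X _ _ (iota 0 k) (iota 0 k) idI) => //.
  - exact: iota_uniq.
  - exact: iota_uniq.
  - by have [c] := hw k; rewrite /I => ->; rewrite ek mul0r scaler0.
  - by have [c] := lw k; rewrite /I => ->; rewrite ek mulr0 scaler0.
exists l; split=> //; move: Il; rewrite /I /root_prod !rmorph_prod /= => <-.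
apply: eq_bigr => a _.
by rewrite !rmorphB /= horner_mx_X horner_mx_C evH !rmorph_int.
Qed.

Theorem sl2_semisimple (F : numFieldType) (n : nat) (e f h : 'M[F]_n) :
  sl2_triple e f h ->
  diagonalizable h /\ forall a, eigenvalue h a -> exists z : int, a = z%:~R.
Proof.
case: n e f h => [|n] e f h triple.
  split; first by rewrite [h]thinmx0; exact: diagonalizable0.
  by move=> a; rewrite /eigenvalue thinmx0 eqxx.
have [l [ul hl]] := sl2_weight_poly _ _ _ _ _ triple.
have hl' : mxminpoly h %| \prod_(x <- [seq a%:~R | a <- l]) ('X - x%:P).
  by rewrite big_map; apply/mxminpoly_minP.
split.
  apply/diagonalizableP; exists [seq a%:~R | a <- l] => //.
  by rewrite map_inj_uniq //; exact: intr_inj.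
move=> a; rewrite eigenvalue_root_min => /(root_dvdp hl').
rewrite root_prod_XsubC => /mapP[z _ ->]; by exists z.
Qed.

(** Conjugation in SL2 by a Cayley transform turns the rotation generator
    into a multiple of H; only the resulting identities are needed, w being a square
    root of -1. *)
Lemma cayley_triple (F : numFieldType) (n : nat) (w : F) (E Fm H : 'M[F]_n) :
  w ^+ 2 = -1 -> sl2_triple E Fm H ->
  sl2_triple (2^-1 *: (H + w *: (E + Fm))) (2^-1 *: (H - w *: (E + Fm)))
     (w *: (Fm - E)).
Proof.
move=> w2 [HE HF EF].
have HE' : H *m E = E *m H + E *+ 2 by rewrite -HE addrC subrK.
have HF' : H *m Fm = Fm *m H - Fm *+ 2 by rewrite -HF addrC subrK.
have EF' : E *m Fm = Fm *m E + H by rewrite -EF addrC subrK.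
(* Once the words in E, Fm, H are in the order Fm, E, H they can be
   treated as independent matrices, and each identity holds entrywise by commutative algebra. *)
split; rewrite -![_ * _]/(_ *m _);
  rewrite ?(mulmxDl, mulmxDr, mulmxBl, mulmxBr, mulmxN, mulNmx,
            =^~scalemxAl, =^~scalemxAr) HE' HF' EF';
  move: (E *m E) (E *m H) (Fm *m H) (Fm *m E) (Fm *m Fm) (H *m H)
    => EE EH FH FE FF HH;
  by apply/matrixP => i j; rewrite !mxE; field: w2.
Qed.

Lemma diagonalizableZ (F : fieldType) (n : nat) (c : F) (A : 'M[F]_n) :
  diagonalizable A -> diagonalizable (c *: A).
Proof.
case=> P Pu /(diagonalizable_forP _ Pu) dA; exists P => //.
apply/(diagonalizable_forP _ Pu) => i j ij.
by rewrite -scalemxAr -scalemxAl mxE dA ?mulr0.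
Qed.

Lemma eigenvalueZ (F : fieldType) (n : nat) (c : F) (A : 'M[F]_n) (a : F) :
  eigenvalue A a -> eigenvalue (c *: A) (c * a).
Proof.
case/eigenvalueP=> v vA v0; apply/eigenvalueP; exists v => //.
by rewrite -scalemxAr vA scalerA.
Qed.

(** * Triangular form and a vanishing trace *)

Lemma trig_mulmx (F : fieldType) (n : nat) (S T : 'M[F]_n) :
  is_trig_mx S -> is_trig_mx T ->
  is_trig_mx (S *m T) /\ forall i, (S *m T) i i = S i i * T i i.
Proof.
move=> /is_trig_mxP tS /is_trig_mxP tT; split.
  apply/is_trig_mxP => i j ij; rewrite mxE big1 // => k _.
  have [ik|ki] := ltnP i k; first by rewrite tS ?mul0r.
  by rewrite tT ?mulr0 // (leq_ltn_trans ki).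
move=> i; rewrite mxE (bigD1 i) //= big1 ?addr0 // => k ki.
have [ik|] := ltnP i k; first by rewrite tS ?mul0r.
by rewrite leq_eqVlt val_eqE (negPf ki) /= => ki'; rewrite tT ?mulr0.
Qed.

Lemma trig_horner (F : fieldType) (n : nat) (T : 'M[F]_n.+1) (q : {poly F}) :
  is_trig_mx T ->
  is_trig_mx (horner_mx T q) /\ forall i, horner_mx T q i i = q.[T i i].
Proof.
move=> tT; elim/poly_ind: q => [|q c [tq dq]].
  by rewrite rmorph0; split=> [|i]; rewrite ?mx0_is_trig // mxE horner0.
rewrite rmorphD rmorphM /= horner_mx_X horner_mx_C.
have [tqT dqT] := trig_mulmx _ _ _ _ tq tT; split.
  apply/is_trig_mxP => i j ij; rewrite mxE.
  rewrite (is_trig_mxP tqT) // add0r mxE; case: eqP => // ij'.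
  by move: ij; rewrite ij' ltnn.
move=> i; rewrite mxE dqT dq mxE eqxx mulr1n.
by rewrite hornerD hornerM hornerX hornerC.
Qed.

Lemma trig_diag_eigenvalue (F : fieldType) (n : nat) (P X T : 'M[F]_n.+1) (i : 'I_n.+1) :
  P \in unitmx -> T = P *m X *m invmx P -> is_trig_mx T -> eigenvalue X (T i i).
Proof.
move=> Pu eT tT; rewrite eigenvalue_root_min.
have <- : mxminpoly T = mxminpoly X by rewrite eT -conjumx // mxminpoly_uconj.
rewrite root_mxminpoly char_poly_trig // /root horner_prod.
by rewrite (bigD1 i) //= hornerXsubC subrr mul0r.
Qed.

Lemma trig_form (C : numClosedFieldType) (n : nat) (X : 'M[C]_n.+1) :
  exists P T : 'M[C]_n.+1, [/\ P \in unitmx, T = P *m X *m invmx P & is_trig_mx T].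
Proof.
have [P Pun /= tX] := Schur X (ltn0Sn n).
have Pu : P \in unitmx by exact: unitarymx_unit.
exists P, (P *m X *m invmx P); split=> //; by rewrite -conjumx.
Qed.

(** The characteristic polynomial splits, so it is a power of X. *)
Lemma only_zero_eigenvalue (C : numClosedFieldType) (n : nat) (X : 'M[C]_n.+1) :
  (forall a, eigenvalue X a -> a = 0) -> \tr X = 0.
Proof.
move=> X0; have cX : char_poly X = 'X^(n.+1).
  have [r rE] := closed_field_poly_normal (char_poly X).
  have lc : lead_coef (char_poly X) = 1 by apply/eqP/char_poly_monic.
  rewrite lc scale1r in rE.
  have r0 : r = nseq (size r) 0.
    apply/all_pred1P/allP => z zr /=; apply/eqP/X0.
    by rewrite eigenvalue_root_char rE root_prod_XsubC.
  have szr : size r = n.+1.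
    by apply: succn_inj; rewrite -(size_prod_XsubC r id) -rE size_char_poly.
  rewrite rE r0 big_nseq szr subr0.
  by elim: n.+1 => [|k IHk] /=; rewrite ?expr0 // IHk exprS.
by apply/eqP; rewrite -oppr_eq0 -char_poly_trace // cX coefXn /= ltn_eqF.
Qed.

Section NilpotentTrace.
Variables (F : numFieldType) (n : nat) (E Z M : 'M[F]_n.+1).
Hypothesis EZ : E * Z - Z * E = M.
Hypothesis EM : E * M = M * E.

Lemma comm_power_bracket j : E ^+ j.+1 * Z = Z * E ^+ j.+1 + (M * E ^+ j) *+ j.+1.
Proof.
have EZ' : E * Z = Z * E + M by rewrite -EZ addrC subrK.
elim: j => [|j IHj]; first by rewrite expr1 expr0 mulr1 EZ'.
rewrite exprS -mulrA IHj mulrDr mulrnAr !mulrA EZ' EM mulrDl -!mulrA -!exprS.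
by rewrite -addrA [in RHS]mulrS.
Qed.

(** If M^a E^(j+1) = 0, multiplying by Z and then by M^a on the right gives
    (j + 1) M^(2a+1) E^j = 0, so the exponent of E can be lowered to 0. *)
Lemma comm_bracket_nilpotent k : E ^+ k = 0 -> exists a, M ^+ a = 0.
Proof.
move=> Ek; suff: forall j, (exists a, M ^+ a * E ^+ j = 0) -> exists a, M ^+ a = 0.
  by move=> /(_ k); apply; exists 0%N; rewrite Ek mulr0.
elim=> [[a]|j IHj [a aj]]; first by rewrite expr0 mulr1; exists a.
apply: IHj; exists (a + a.+1)%N.
have cEM : E ^+ j.+1 * M ^+ a = M ^+ a * E ^+ j.+1.
  by apply/commr_sym/commrX/commr_sym/commrX/commr_sym.
have cEM' : E ^+ j * M ^+ a = M ^+ a * E ^+ j.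
  by apply/commr_sym/commrX/commr_sym/commrX/commr_sym.
have := congr1 (fun x => x * Z * M ^+ a) aj.
rewrite /= !mul0r -(mulrA _ _ Z) comm_power_bracket mulrDr mulrDl.
rewrite -2!mulrA cEM aj !mulr0 add0r => /eqP.
rewrite mulrnAr mulrnAl -scaler_nat scaler_eq0 pnatr_eq0 /= => /eqP.
by rewrite -!mulrA cEM' (mulrA M) -exprS !mulrA -exprD.
Qed.

End NilpotentTrace.

(** The product ZE has no nonzero eigenvalue l: for an eigenvector v and the
    last r with v E^r nonzero, v E^r would be an eigenvector of the nilpotent
    matrix M = EZ - ZE for - l / (r + 1). *)
Lemma nilpotent_trace (C : numClosedFieldType) (n : nat) (E Z : 'M[C]_n.+1) k :
  E ^+ k = 0 -> E * (E * Z - Z * E) = (E * Z - Z * E) * E -> \tr (E *m Z) = 0.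
Proof.
move=> Ek EM; set M := E * Z - Z * E in EM.
have [a Ma] := comm_bracket_nilpotent _ _ E Z M erefl EM k Ek.
rewrite mxtrace_mulC; apply: (only_zero_eigenvalue _ _ (Z * E)) => l.
case/eigenvalueP=> v vl v0; apply/eqP; apply: contraT => l0.
have [r [vr vr1]] : exists r, v *m E ^+ r != 0 /\ v *m E ^+ r.+1 = 0.
  have : exists m, v *m E ^+ m == 0 by exists k; rewrite Ek mulmx0.
  case/ex_minnP=> -[|m]; first by rewrite expr0 mulmx1 (negPf v0).
  move=> /eqP vm mmin; exists m; split=> //.
  by apply/negP => /mmin; rewrite ltnn.
set w := v *m E ^+ r in vr.
have wM : w *m M = - (l / r.+1%:R) *: w.
  apply: (@scalerI _ _ (r.+1%:R)); first by rewrite pnatr_eq0.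
  rewrite scalerA mulrN mulrC divfK ?pnatr_eq0 // scaleNr [in RHS]/w [in RHS]scalemxAl -vl.
  rewrite -[in RHS]mulmxA (_ : Z * E *m E ^+ r = Z * E ^+ r.+1); last first.
    by rewrite exprS mulrA.
  apply/eqP; rewrite -addr_eq0 addrC.
  have := comm_power_bracket _ _ E Z M erefl EM r.
  move=> /(congr1 (mulmx v)); rewrite mulmxA vr1 mul0mx mulmxDr => /esym/eqP.
  congr (_ == _); congr (_ + _).
  rewrite -scaler_nat -scalemxAr /w -mulmxA; congr (_ *: (_ *m _)).
  by apply/commrX/commr_sym.
have wMa b : w *m M ^+ b = (- (l / r.+1%:R)) ^+ b *: w.
  elim: b => [|b IHb]; first by rewrite !expr0 mulmx1 scale1r.
  by rewrite !exprSr mulmxA IHb -scalemxAl wM scalerA.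
move: (wMa a); rewrite Ma mulmx0 => /esym/eqP; rewrite scaler_eq0 (negPf vr).
by rewrite orbF expf_eq0 oppr_eq0 mulf_eq0 invr_eq0 pnatr_eq0 (negPf l0) andbF.
Qed.


Lemma nilpotent_trace_mx (C : numClosedFieldType) (n : nat) (E Z : 'M[C]_n) k :
  E ^+ k = 0 -> E *m (E *m Z - Z *m E) = (E *m Z - Z *m E) *m E ->
  \tr (E *m Z) = 0.
Proof.
case: n E Z => [|n] E Z Ek EM; first by rewrite [E *m Z]thinmx0 mxtrace0.
exact: (nilpotent_trace _ _ E Z k Ek EM).
Qed.

(** * Derivations and the vanishing of the Killing form *)

(** Chinese remaindering for the powers (X - a)^N. *)
Lemma poly_interpolation (F : fieldType) (N : nat) (f : F -> F) (s : seq F) :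
  uniq s -> exists q : {poly F}, forall a, a \in s -> ('X - a%:P) ^+ N %| q - (f a)%:P.
Proof.
elim: s => [|a s IHs]; first by exists 0.
case/andP=> ans us; have [q0 q0P] := IHs us.
pose P := \prod_(b <- s) ('X - b%:P) ^+ N.
have cP : coprimep P (('X - a%:P) ^+ N).
  rewrite /P; elim: (s) ans => [|b t IHt]; first by rewrite big_nil coprime1p.
  rewrite inE negb_or => /andP[ab at_]; rewrite big_cons coprimepMl IHt // andbT.
  apply/coprimep_expl/coprimep_expr; by rewrite coprimep_XsubC root_XsubC.
have [[u v] /= uv] := Bezout_coprimepP _ _ cP.
have [c c0 uvc] : exists2 c, c != 0 & u * P + v * ('X - a%:P) ^+ N = c%:P.
  have /size_poly1P[c c0 ->] : size (u * P + v * ('X - a%:P) ^+ N) == 1%N.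
    by rewrite size_poly_eq1.
  by exists c.
exists (q0 + c^-1%:P * u * P * ((f a)%:P - q0)) => b.
rewrite inE => /orP[/eqP->|bs].
  have -> : q0 + c^-1%:P * u * P * ((f a)%:P - q0) - (f a)%:P
     = (q0 - (f a)%:P) * c^-1%:P * v * ('X - a%:P) ^+ N.
    have c1 : c^-1%:P * c%:P = 1 :> {poly F} by rewrite -polyCM mulVf.
    have -> : (q0 - (f a)%:P) * c^-1%:P * v * ('X - a%:P) ^+ N =
       (q0 - (f a)%:P) * (c^-1%:P * (v * ('X - a%:P) ^+ N)) by ring.
    have -> : v * ('X - a%:P) ^+ N = c%:P - u * P by rewrite -uvc; ring.
    by rewrite [in RHS]mulrBr c1; ring.
  exact: dvdp_mull.
rewrite addrAC dvdp_add ?q0P // dvdp_mulr // dvdp_mull //.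
by rewrite /P (big_rem b) //= dvdp_mulr.
Qed.

(** Induction over sums of generalized eigenvectors: the space is the sum of
    the kernels of the coprime factors (X - a)^(n + 1), whose product the
    characteristic polynomial divides. *)
Lemma geigen_ind (C : numClosedFieldType) (n : nat) (X : 'M[C]_n.+1)
    (P : 'rV[C]_n.+1 -> Prop) :
  (forall u v, P u -> P v -> P (u + v)) ->
  (forall a v, v *m (X - a%:M) ^+ n.+1 = 0 -> P v) -> forall v, P v.
Proof.
move=> Padd Pgen v.
have [r rE] := closed_field_poly_normal (char_poly X).
have lc : lead_coef (char_poly X) = 1 by apply/eqP/char_poly_monic.
rewrite lc scale1r in rE.
pose s := undup r; pose N := size r.
have szr : N = n.+1.
  by apply: succn_inj; rewrite -(size_prod_XsubC r id) -rE size_char_poly.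
have dvd_s : char_poly X %| \prod_(a <- s) ('X - a%:P) ^+ N.
  rewrite rE prodrXl /N; have: {subset r <= s} by move=> a; rewrite mem_undup.
  elim: (r) => [|a t IHt] sub; first by rewrite big_nil dvd1p.
  rewrite big_cons /= exprS dvdp_mul //; last first.
    by apply: IHt => b bt; apply: sub; rewrite inE bt orbT.
  by rewrite dvdp_XsubCl root_prod_XsubC sub ?inE ?eqxx.
pose p_ (i : 'I_(size s)) := ('X - (s`_i)%:P) ^+ N.
have prodE : \prod_(a <- s) ('X - a%:P) ^+ N = \prod_i p_ i.
  by rewrite (big_nth 0) big_mkord.
have cop : {in predT &, forall i j, j != i -> coprimep (p_ i) (p_ j)}.
  move=> i j _ _ ij; apply/coprimep_expl/coprimep_expr.
  by rewrite coprimep_XsubC root_XsubC nth_uniq ?undup_uniq // eq_sym.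
have := kermxpoly_prod X cop.
rewrite -prodE => ker.
have v_in : (v <= \sum_i kermxpoly X (p_ i))%MS.
  rewrite -ker; apply: submx_trans (submx1 _) _.
  apply/sub_kermxP; rewrite mul1mx.
  have /dvdpP[q ->] := dvd_s.
  by rewrite rmorphM /= Cayley_Hamilton mulr0.
have P0 : P 0 by apply: (Pgen 0); rewrite mul0mx.
have [u ->] := sub_sumsmxP v_in.
apply: (big_ind P) => // i _; apply: (Pgen s`_i).
have <- : horner_mx X (p_ i) = (X - (s`_i)%:M) ^+ n.+1.
  by rewrite rmorphXn /= rmorphB /= horner_mx_X horner_mx_C szr.
by rewrite -mulmxA mulmx_ker mulmx0.
Qed.

(** The adjoint representation of the algebra with structure matrices A i, the
    matrix of the adjoint action of the i-th basis vector. *)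
Definition row_ad {F : pzRingType} {n : nat} (A : 'I_n -> 'M[F]_n) (x : 'rV[F]_n)
  : 'M[F]_n := \sum_i x 0 i *: A i.

(** Antisymmetry and the Jacobi identity for the bracket [x, y] = y *m ad x. *)
Definition row_lie {F : pzRingType} {n : nat} (A : 'I_n -> 'M[F]_n) : Prop :=
  (forall x y, y *m row_ad A x = - (x *m row_ad A y)) /\
  (forall x y, row_ad A (y *m row_ad A x) =
     row_ad A y *m row_ad A x - row_ad A x *m row_ad A y).

Section RowAdLinear.
Variables (F : comPzRingType) (n : nat) (A : 'I_n -> 'M[F]_n).
Notation ad := (row_ad A).

Lemma row_adD x y : ad (x + y) = ad x + ad y.
Proof. by rewrite /row_ad -big_split; apply: eq_bigr => i _; rewrite mxE scalerDl. Qed.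

Lemma row_adZ a x : ad (a *: x) = a *: ad x.
Proof. by rewrite /row_ad scaler_sumr; apply: eq_bigr => i _; rewrite mxE scalerA. Qed.

Lemma row_adB x y : ad (x - y) = ad x - ad y.
Proof. by rewrite row_adD -scaleN1r row_adZ scaleN1r. Qed.

Lemma row_ad_sum (I : finType) (f : I -> 'rV[F]_n) :
  ad (\sum_i f i) = \sum_i ad (f i).
Proof.
apply: (big_morph ad row_adD).
by rewrite /row_ad big1 // => i _; rewrite mxE scale0r.
Qed.

Lemma row_ad_mul x y : y *m ad x = \sum_i \sum_j (x 0 i * y 0 j) *: row j (A i).
Proof.
rewrite /row_ad mulmx_sumr; apply: eq_bigr => i _.
rewrite -scalemxAr mulmx_sum_row scaler_sumr.
by apply: eq_bigr => j _; rewrite scalerA.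
Qed.

Lemma row_lie_of_basis :
  (forall i j, row j (A i) = - row i (A j)) ->
  (forall i j, ad (row j (A i)) = A j *m A i - A i *m A j) -> row_lie A.
Proof.
move=> anti jac; split=> x y.
  rewrite !row_ad_mul exchange_big /= -sumrN; apply: eq_bigr => j _.
  rewrite -sumrN; apply: eq_bigr => i _.
  by rewrite anti scalerN mulrC.
rewrite row_ad_mul row_ad_sum.
rewrite [ad y *m ad x]mulmx_sumr [ad x *m ad y]mulmx_suml -sumrB.
apply: eq_bigr => i _; rewrite row_ad_sum mulmx_suml mulmx_sumr -sumrB.
apply: eq_bigr => j _; rewrite row_adZ jac scalerBr -!scalemxAr -!scalemxAl.
by rewrite !scalerA [y 0 j * x 0 i]mulrC.
Qed.

End RowAdLinear.

Section RowLie.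
Variables (C : numClosedFieldType) (n : nat) (A : 'I_n.+1 -> 'M[C]_n.+1).
Hypothesis lieA : row_lie A.
Notation ad := (row_ad A).

(** Leibniz rule: [ad z - (a + b)] acts on [u, v] as ad z - a on u plus
    ad z - b on v. *)
Lemma geigen_bracket (z u v : 'rV[C]_n.+1) (a b : C) (k l : nat) :
  u *m (ad z - a%:M) ^+ k = 0 -> v *m (ad z - b%:M) ^+ l = 0 ->
  (v *m ad u) *m (ad z - (a + b)%:M) ^+ (k + l) = 0.
Proof.
have [anti jac] := lieA.
move: {2}(k + l)%N (leqnn (k + l)) => m.
elim: m k l u v => [|m IHm] k l u v.
  rewrite leqn0 addn_eq0 => /andP[/eqP-> /eqP->].
  by rewrite expr0 mulmx1 => -> _; rewrite anti !mul0mx oppr0 mul0mx.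
case: k => [|k] klm.
  by rewrite expr0 mulmx1 => -> _; rewrite anti !mul0mx oppr0 mul0mx.
case: l klm => [|l] klm.
  by rewrite expr0 mulmx1 => _ ->; rewrite !mul0mx.
move=> uk vl.
have uk' : u *m (ad z - a%:M) *m (ad z - a%:M) ^+ k = 0.
  by move: uk; rewrite exprS -[_ * _]/(_ *m _) mulmxA.
have vl' : v *m (ad z - b%:M) *m (ad z - b%:M) ^+ l = 0.
  by move: vl; rewrite exprS -[_ * _]/(_ *m _) mulmxA.
have step : (v *m ad u) *m (ad z - (a + b)%:M) =
  v *m ad (u *m (ad z - a%:M)) + (v *m (ad z - b%:M)) *m ad u.
  have -> : ad (u *m (ad z - a%:M)) = ad u *m ad z - ad z *m ad u - a *: ad u.
    by rewrite mulmxBr mul_mx_scalar row_adB row_adZ jac.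
  rewrite [LHS]mulmxBr 2![v *m (_ - _)]mulmxBr mulmxBr mulmxBl.
  rewrite !mul_mx_scalar -scalemxAl -scalemxAr !mulmxA scalerDl opprD.
  rewrite -!addrA; congr (_ + _); rewrite [RHS]addrCA; congr (_ + _).
  by rewrite addrA addNr add0r.
rewrite addSn exprS -[_ * _]/(_ *m _) mulmxA step mulmxDl.
rewrite (IHm k l.+1 _ _ _ uk' vl) ?add0r; last by rewrite -ltnS -addSn.
by rewrite addnS -addSn (IHm k.+1 l _ _ _ uk vl') // -ltnS -addnS.
Qed.

Lemma derivation_trace (D : 'M[C]_n.+1) (x y : 'rV[C]_n.+1) :
  (forall u, ad (u *m D) = ad u *m D - D *m ad u) ->
  \tr (ad (y *m ad x) *m D) = \tr (ad y *m ad (x *m D)).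
Proof.
have [anti jac] := lieA => derD.
rewrite jac derD mulmxBl mulmxBr !linearB /= !mulmxA; congr (_ - _).
by rewrite -mulmxA mxtrace_mulC.
Qed.

(** The operator that multiplies the generalized eigenspace for a by the
    conjugate of a is a polynomial in ad z; it is a derivation since brackets add
    eigenvalues and conjugation is additive. *)
Lemma conj_derivation (z : 'rV[C]_n.+1) : exists q : {poly C},
  (forall a, eigenvalue (ad z) a -> q.[a] = a^* ) /\
  let D : 'M[C]_n.+1 := horner_mx (ad z) q in
  forall u, ad (u *m D) = ad u *m D - D *m ad u.
Proof.
set X := ad z.
have [r rE] := closed_field_poly_normal (char_poly X).
have lc : lead_coef (char_poly X) = 1 by apply/eqP/char_poly_monic.
rewrite lc scale1r in rE.
have rP a : (a \in undup r) = eigenvalue X a.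
  by rewrite mem_undup eigenvalue_root_char rE root_prod_XsubC.
(* The exponent 2(n + 1) is the one that geigen_bracket gives for the bracket
   of two generalized eigenvectors. *)
pose N := (n.+1 + n.+1)%N.
have [q qP] := poly_interpolation C N (fun a => a^*) (undup r) (undup_uniq r).
exists q; split=> [a|D u].
  rewrite -rP => /qP; have -> : N = (n + n.+1).+1 by [].
  rewrite exprS => /(dvdp_trans (dvdp_mulr _ (dvdpp _))).
  by rewrite dvdp_XsubCl /root !hornerE subr_eq0 => /eqP.
have gD a (v : 'rV[C]_n.+1) : v *m (X - a%:M) ^+ N = 0 -> v *m D = a^* *: v.
  move=> va; have [ea|nea] := boolP (eigenvalue X a).
    have /dvdpP[w wE] := qP a (etrans (rP a) ea).
    have qE : q = ('X - a%:P) ^+ N * w + (a^*)%:P by rewrite mulrC -wE subrK.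
    have -> : D = (X - a%:M) ^+ N *m horner_mx X w + (a^*)%:M.
      rewrite /D qE rmorphD rmorphM rmorphXn rmorphB /=.
      by rewrite horner_mx_X !horner_mx_C.
    by rewrite mulmxDr mulmxA va mul0mx add0r mul_mx_scalar.
  have -> : v = 0; last by rewrite mul0mx scaler0.
  have unitXa : X - a%:M \in unitmx.
    by move: nea; rewrite /eigenvalue /eigenspace -row_free_unit -kermx_eq0 negbK.
  apply: (can_inj (mulmxK (unitrX N unitXa))); rewrite mul0mx; exact: va.
apply/row_matrixP => i; rewrite !rowE.
move: (delta_mx 0 i) => v {i}.
have [anti jac] := lieA.
move: u; apply: (geigen_ind _ _ X) => [u1 u2 e1 e2|a u ua].
rewrite (mulmxDl u1) !row_adD [LHS]mulmxDr e1 e2 -(mulmxDr v).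
  by rewrite (mulmxDl (ad u1)) (mulmxDr D) opprD addrACA.
move: v; apply: (geigen_ind _ _ X) => [v1 v2 e1 e2|b v vb].
  by rewrite !mulmxDl e1 e2.
have up (w : 'rV_n.+1) (c : C) : w *m (X - c%:M) ^+ n.+1 = 0 -> 
   w *m (X - c%:M) ^+ N = 0.
  by rewrite exprD -[_ * _]/(_ *m _) mulmxA => ->; rewrite mul0mx.
rewrite (gD a) ?up // row_adZ mulmxBr !mulmxA (gD b v) ?up //.
rewrite (gD (a + b) (v *m ad u)); last exact: geigen_bracket.
by rewrite -scalemxAr -scalemxAl rmorphD /= scalerDl addrK.
Qed.

(** As z is a sum of brackets, the trace of (ad z) D is a sum of values of the
    Killing form, hence 0; in a triangular basis it is the sum of |a|^2 over the
    eigenvalues a of ad z. *)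
Lemma ad_nilpotent_of_killing0 (z : 'rV[C]_n.+1) (u : 'I_n.+1 -> 'rV[C]_n.+1) :
  (forall x y, \tr (ad x *m ad y) = 0) ->
  z = \sum_i u i *m A i ->
  ad z ^+ n.+1 = 0.
Proof.
move=> kill zE; have [q [qE derD]] := conj_derivation z.
set X := ad z in qE derD *; set D := horner_mx X q in derD.
have A_ad i : A i = ad (delta_mx 0 i).
  rewrite /row_ad (bigD1 i) //= mxE !eqxx scale1r big1 ?addr0 // => j ji.
  by rewrite mxE eqxx (negPf ji) scale0r.
have trXD : \tr (X *m D) = 0.
  rewrite /X zE; elim/big_ind: _ => [|x y ex ey|i _].
  - by rewrite -(scale0r 0) row_adZ scale0r mul0mx linear0.
  - by rewrite row_adD mulmxDl linearD /= ex ey addr0.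
  - by rewrite A_ad derivation_trace.
have [P [T [Pu eT tT]]] := trig_form _ _ X.
have trT : \tr (X *m D) = \sum_i T i i * (T i i)^*.
  have [tq dq] := trig_horner _ _ T q tT.
  have [_ dTq] := trig_mulmx _ _ _ _ tT tq.
  transitivity (\tr (T *m horner_mx T q)).
    have -> : horner_mx T q = P *m D *m invmx P by rewrite eT horner_mx_uconj.
    rewrite eT !mulmxA mulmxKV // [RHS]mxtrace_mulC.
    by rewrite !mulmxA mulVmx // mul1mx.
  apply: eq_bigr => i _; rewrite dTq dq qE //.
  exact: trig_diag_eigenvalue eT tT.
have T0 i : T i i = 0.
  apply/eqP; rewrite -normr_eq0 -sqrf_eq0 normCK.
  move: trT; rewrite trXD => /esym/eqP; rewrite psumr_eq0 => [/allP|j _].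
    by move/(_ i (mem_index_enum i)).
  exact: mul_conjC_ge0.
have := Cayley_Hamilton T; rewrite char_poly_trig //.
rewrite (eq_bigr (fun=> 'X)) => [|i _]; last by rewrite T0 subr0.
rewrite prodr_const card_ord rmorphXn /= horner_mx_X => Tn.
have : P *m X ^+ n.+1 *m invmx P = 0.
  have <- : horner_mx X 'X^(n.+1) = X ^+ n.+1 by rewrite rmorphXn /= horner_mx_X.
  by rewrite -horner_mx_uconj // -eT rmorphXn /= horner_mx_X.
move=> /(congr1 (fun M => invmx P *m M *m P)).
by rewrite !mulmxA mulVmx // mul1mx mulmxKV // mulmx0 mul0mx.
Qed.

End RowLie.

Lemma ad_nilpotent_of_killing_eq0 (C : numClosedFieldType) (n : nat)
    (A : 'I_n -> 'M[C]_n) (z : 'rV[C]_n) (u : 'I_n -> 'rV[C]_n) :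
  row_lie A ->
  (forall x y, \tr (row_ad A x *m row_ad A y) = 0) ->
  z = \sum_i u i *m A i ->
  exists k, row_ad A z ^+ k = 0.
Proof.
case: n A z u => [|n] A z u lieA kill zE.
  by exists 0%N; rewrite [LHS]thinmx0 [RHS]thinmx0.
exists n.+1.
exact: (ad_nilpotent_of_killing0 _ _ _ lieA _ _ kill zE).
Qed.

(** * Surjectivity of H + 2 on the kernel of E *)

Section Morozov.
Variables (F : numFieldType) (n : nat) (E H Y : 'M[F]_n.+1).
Hypothesis EH : E * H - H * E = E *+ 2.
Hypothesis YE : Y * E - E * Y = H.

Lemma weight_shift : H * E = E * (H - 2%:R).
Proof. by rewrite mulrBr mulr_natr -EH opprB addrC subrK. Qed.

Lemma weight_shift_sub i : (H - i%:R) * E = E * (H - i.+1%:R - 1).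
Proof.
rewrite -addrA -opprD -natr1 -addrA [i%:R + _]addrC opprD addrA.
by rewrite mulrBr -weight_shift mulrBl mulr_natr mulr_natl.
Qed.

(** The commutator of Y with E^(i+1) is a sum of i + 1 terms E^a H E^b, which
    are all brought to the form E^i (H - 2b). *)
Lemma commutator_powers i :
  Y * E ^+ i.+1 - E ^+ i.+1 * Y = (E ^+ i * (H - i%:R)) *+ i.+1.
Proof.
elim: i => [|i IHi]; first by rewrite expr1 expr0 mul1r subr0 YE.
have split_off (P : 'M[F]_n.+1) :
    Y * (P * E) - P * E * Y = (Y * P - P * Y) * E + P * (Y * E - E * Y).
  by rewrite mulrBl mulrBr !mulrA addrA subrK.
rewrite (exprSr E i.+1) split_off.
rewrite IHi YE mulrnAl -mulrA weight_shift_sub mulrA -exprSr -mulrnAr -mulrDr.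
rewrite -mulrnAr; congr (_ * _).
set G := H - i.+1%:R - 1.
have eG : H - i.+1%:R = G + 1 by rewrite /G subrK.
have eH : H = G + i.+2%:R.
  by rewrite -(natr1 i.+1) [i.+1%:R + 1]addrC addrA -eG subrK.
by rewrite eG [X in _ + X]eH addrA -mulrSr -mulrnDl.
Qed.

Lemma killed_horner (z : 'rV[F]_n.+1) (p : {poly F}) :
  z *m E = 0 -> z *m horner_mx H p *m E = 0.
Proof.
move=> zE; elim/poly_ind: p => [|p c IHp]; first by rewrite rmorph0 mulmx0 mul0mx.
rewrite rmorphD rmorphM /= horner_mx_X horner_mx_C mulmxDr mulmxDl.
rewrite mul_mx_scalar -scalemxAl zE scaler0 addr0 -[_ * _]/(_ *m _).
by rewrite -!mulmxA [H *m E]weight_shift mulmxA mulmxA IHp mul0mx.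
Qed.

(** On the kernel of E the operator H - j maps the image of E^j into the image
    of E^(j+1).  As E is nilpotent, a product of factors H - j with j >= 0 vanishes
    on the kernel, and -2 is not a root of it. *)
Lemma morozov_shift_onto (z : 'rV[F]_n.+1) k :
  E ^+ k = 0 -> z *m E = 0 ->
  exists2 w, w *m E = 0 & w *m H + w *+ 2 = z.
Proof.
move=> Ek zE.
pose P (j : nat) : {poly F} := \prod_(i < j) ('X - (i%:R)%:P).
have PP j : exists v, z *m horner_mx H (P j) = v *m E ^+ j.
  elim: j => [|j [v IHj]].
    by exists z; rewrite /P big_ord0 rmorph1 !mulmx1.
  exists (j.+1%:R^-1 *: (v *m Y)).
  rewrite /P big_ord_recr /= rmorphM rmorphB /= horner_mx_X horner_mx_C.
  rewrite -[_ * _]/(_ *m _) mulmxA IHj.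
  have := commutator_powers j; move/(congr1 (mulmx v)).
  (* The vector v E^j = z P_j(H) is still killed by E. *)
  have vE : v *m E ^+ j.+1 = 0.
    by rewrite exprSr -[_ * _]/(_ *m _) mulmxA -IHj killed_horner.
  rewrite mulmxBr [v *m (E ^+ j.+1 * Y)]mulmxA vE mul0mx subr0.
  rewrite mulmxA -scalemxAl => ->.
  have scal (A : 'M[F]_n.+1) m : v *m (A *+ m) = m%:R *: (v *m A).
    by rewrite scalemxAr scaler_nat.
  rewrite scal scalerA mulVf ?pnatr_eq0 // scale1r mulmxA.
  by rewrite (rmorph_nat scalar_mx).
have [v] := PP k; rewrite Ek mulmx0 => zP.
pose c := (P k).[-2%:R].
have c0 : c != 0.
  rewrite /c horner_prod prodf_seq_neq0; apply/allP => i _ /=.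
  by rewrite hornerXsubC -opprD oppr_eq0 -natrD pnatr_eq0.
have /factor_theorem[q qE] : root (P k - c%:P) (-2%:R).
  by rewrite /root !hornerE subrr.
exists (- c^-1 *: (z *m horner_mx H q)).
  by rewrite -scalemxAl killed_horner // scaler0.
have zE' : z = - c^-1 *: (z *m horner_mx H (P k - c%:P)).
  rewrite rmorphB /= horner_mx_C mulmxBr zP sub0r mul_mx_scalar.
  by rewrite scalerN scaleNr opprK scalerA mulVf // scale1r.
rewrite [RHS]zE' qE rmorphM rmorphB /= horner_mx_X horner_mx_C.
rewrite -scalemxAl scalerMnr -scalerDr; congr (_ *: _).
rewrite -[_ * _]/(_ *m _) mulmxA mulmxBr mul_mx_scalar scaleNr opprK.
by rewrite scaler_nat.
Qed.

End Morozov.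

Lemma morozov_shift_onto_mx (F : numFieldType) (n : nat) (E H Y : 'M[F]_n)
    (z : 'rV[F]_n) k :
  E *m H - H *m E = E *+ 2 -> Y *m E - E *m Y = H ->
  E ^+ k = 0 -> z *m E = 0 ->
  exists2 w, w *m E = 0 & w *m H + w *+ 2 = z.
Proof.
case: n E H Y z => [|n] E H Y z EH YE Ek zE.
  by exists 0; rewrite ?mul0mx // mul0rn addr0 [RHS]thinmx0.
exact: (morozov_shift_onto _ _ E H Y EH YE z k Ek zE).
Qed.

(** * Brackets of matrices and Engel's theorem *)

(** A subspace of maximal dimension inside P is all of P; this turns
    subspaces given by a property into elements of the lattice of subspaces. *)
Lemma linear_pred_vspace (K : fieldType) (V : vectType K) (P : V -> Prop) :
  P 0 -> (forall a u v, P u -> P v -> P (a *: u + v)) ->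
  exists U : {vspace V}, forall x, x \in U <-> P x.
Proof.
move=> P0 Plin.
pose p m := `[< exists U : {vspace V}, (forall x, x \in U -> P x) /\ \dim U = m >].
have p0 : exists m, p m.
  exists 0%N; apply/asboolP; exists 0%VS; split; last exact: dimv0.
  by move=> x; rewrite memv0 => /eqP->.
have pmax m : p m -> (m <= \dim {:V})%N.
  by move=> /asboolP[U [_ <-]]; rewrite dimvS ?subvf.
have [m /asboolP[U [UP Um]] mmax] := ex_maxnP p0 pmax.
exists U => x; split=> [/UP //|Px]; apply: contraT => xU.
have : p (\dim (U + <[x]>)%VS).
  apply/asboolP; exists (U + <[x]>)%VS; split=> // y /memv_addP[u /UP Pu].
  by move=> [w /vlineP[a ->] ->]; rewrite addrC; apply: Plin.
move/mmax; rewrite -Um => dimle.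
have/eqP UE : U == (U + <[x]>)%VS by rewrite eqEdim addvSl dimle.
by move: xU; rewrite UE (subvP (addvSr _ _)) ?memv_line.
Qed.

Section Bracket.
Variables (R : realType) (n : nat).
Implicit Types x y z : 'M[R]_n.

Lemma bracketC x y : bracket x y = - bracket y x.
Proof. by rewrite /bracket opprB. Qed.

Lemma bracketxx x : bracket x x = 0.
Proof. by rewrite /bracket subrr. Qed.

Lemma bracketDr x y z : bracket x (y + z) = bracket x y + bracket x z.
Proof. by rewrite /bracket mulmxDr mulmxDl opprD addrACA. Qed.

Lemma bracketZr a x y : bracket x (a *: y) = a *: bracket x y.
Proof. by rewrite /bracket -scalemxAr -scalemxAl scalerBr. Qed.

Lemma bracketDl x y z : bracket (x + y) z = bracket x z + bracket y z.
Proof. by rewrite bracketC bracketDr opprD -!bracketC. Qed.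

Lemma bracketZl a x y : bracket (a *: x) y = a *: bracket x y.
Proof. by rewrite bracketC bracketZr -scalerN -bracketC. Qed.

Lemma bracketNr x y : bracket x (- y) = - bracket x y.
Proof. by rewrite -scaleN1r bracketZr scaleN1r. Qed.

Lemma bracket0r x : bracket x 0 = 0.
Proof. by rewrite /bracket mulmx0 mul0mx subr0. Qed.

Lemma bracket0l x : bracket 0 x = 0.
Proof. by rewrite bracketC bracket0r oppr0. Qed.

Lemma bracket_sumr (I : finType) x (f : I -> 'M[R]_n) :
  bracket x (\sum_i f i) = \sum_i bracket x (f i).
Proof.
exact: (big_morph _ (bracketDr x) (bracket0r x)).
Qed.

Lemma bracket_suml (I : finType) x (f : I -> 'M[R]_n) :
  bracket (\sum_i f i) x = \sum_i bracket (f i) x.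
Proof.
exact: (big_morph (fun y => bracket y x) (fun y z => bracketDl y z x) (bracket0l x)).
Qed.

Lemma jacobi x y z :
  bracket (bracket x y) z = bracket x (bracket y z) - bracket y (bracket x z).
Proof.
rewrite /bracket !mulmxBl !mulmxBr !mulmxA.
move: (x *m y *m z) (y *m x *m z) (z *m x *m y) (z *m y *m x) (x *m z *m y) (y *m z *m x).
move=> a b c d a' b'; apply/matrixP => i j; rewrite !mxE; ring.
Qed.

Variable g : {vspace 'M[R]_n}.

Definition bracket_stable (K U : {vspace 'M[R]_n}) : Prop :=
  forall k u, k \in K -> u \in U -> bracket k u \in U.

(** Induction on dim K.  For a maximal proper subalgebra K' of K the
    induction hypothesis, applied to K acting on K / K', gives x in K outside K'
    that normalizes K', so K = K' + <x>.  Applied to U / W it gives vectors u of U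
    outside W with [K', u] in W; these are stable under ad x, and the last nonzero
    power of ad x on U / W produces the required vector. *)
Lemma engel (nilg : forall x, x \in g -> exists k, forall y, y \in g ->
    iter k (bracket x) y = 0) (K W U : {vspace 'M[R]_n}) :
  (K <= g)%VS -> lie_subalgebra K -> (W <= U)%VS -> (U <= g)%VS -> W != U ->
  bracket_stable K W -> bracket_stable K U ->
  exists u, [/\ u \in U, u \notin W & forall k, k \in K -> bracket k u \in W].
Proof.
have [m] := ubnP (\dim K); elim: m K W U => // m IHm K W U.
rewrite ltnS => dimK Kg Ksub WU Ug WnU stW stU.
have [u uU uW] : exists2 u, u \in U & u \notin W.
  by apply/subvPn; apply: contra WnU => UW; rewrite eqEsubv WU.
have [K0|Kn0] := eqVneq K 0%VS.
  exists u; split=> // k; rewrite K0 memv0 => /eqP->; by rewrite bracket0l mem0v.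
pose p m := `[< exists K' : {vspace 'M[R]_n},
  [/\ (K' <= K)%VS, K' != K, lie_subalgebra K' & \dim K' = m] >].
have p0 : exists m, p m.
  exists 0%N; apply/asboolP; exists 0%VS; split; rewrite ?sub0v ?dimv0 1?eq_sym //.
  by move=> x y; rewrite !memv0 => /eqP-> _; rewrite bracket0l.
have pmax l : p l -> (l <= \dim K)%N.
  by move=> /asboolP[K' [K'K _ _ <-]]; rewrite dimvS.
have [l /asboolP[K' [K'K K'nK K'sub K'l]] lmax] := ex_maxnP p0 pmax.
have dimK' : (\dim K' < m)%N.
  apply: leq_trans dimK; rewrite ltnNge; apply: contra K'nK => le.
  by rewrite eqEdim K'K.
have K'g := subv_trans K'K Kg.
have stK'K : bracket_stable K' K.
  by move=> a b /(subvP K'K) aK bK; apply: Ksub.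
have [x [xK xK' xst]] := IHm K' K' K dimK' K'g K'sub K'K Kg K'nK K'sub stK'K.
have KE : K = (K' + <[x]>)%VS.
  apply/eqP; apply: contraT => KnE.
  have addK : (K' + <[x]> <= K)%VS by rewrite subv_add K'K -memvE.
  have : p (\dim (K' + <[x]>)%VS).
    apply/asboolP; exists (K' + <[x]>)%VS; split=> //; first by rewrite eq_sym.
    move=> y z /memv_addP[y1 y1K' [_ /vlineP[a ->] ->]].
    move=> /memv_addP[z1 z1K' [_ /vlineP[b ->] ->]].
    rewrite bracketDl !bracketDr !bracketZl !bracketZr bracketxx !scaler0 addr0.
    have xz1 : bracket x z1 \in K' by rewrite bracketC memvN xst.
    apply: (subvP (addvSl _ _)).
    by apply: memvD; [apply: memvD; [exact: K'sub|exact/memvZ/xst]|exact: memvZ].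
  move/lmax; rewrite -K'l => le.
  have/eqP eK' : K' == (K' + <[x]>)%VS by rewrite eqEdim addvSl le.
  by move: xK'; rewrite eK' (subvP (addvSr _ _)) ?memv_line.
pose PU v := v \in U /\ forall k, k \in K' -> bracket k v \in W.
have PU_st v : PU v -> PU (bracket x v).
  case=> vU vW; split; first exact: stU.
  move=> k kK'; rewrite -[bracket k _](subrK (bracket x (bracket k v))) -jacobi.
  by apply: memvD; [exact/vW/xst | apply: stW => //; exact: vW].
have stK'W : bracket_stable K' W by move=> a b /(subvP K'K); apply: stW.
have stK'U : bracket_stable K' U by move=> a b /(subvP K'K); apply: stU.
have [u0 [u0U u0W u0st]] := IHm K' W U dimK' K'g K'sub WU Ug WnU stK'W stK'U.
have [k kx] := nilg x (subvP Kg _ xK).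
have exq : exists q, iter q (bracket x) u0 \in W.
  by exists k; rewrite kx ?mem0v // (subvP Ug).
case: (ex_minnP exq) => -[|q] qW qmin; first by rewrite qW in u0W.
have [vU vW] : PU (iter q (bracket x) u0) by elim: (q) => //= j; apply: PU_st.
exists (iter q (bracket x) u0); split=> //.
  by apply/negP => /qmin; rewrite ltnn.
move=> y; rewrite KE => /memv_addP[y1 y1K' [_ /vlineP[a ->] ->]].
by rewrite bracketDl bracketZl; apply: memvD; [exact: vW | apply: memvZ; exact: qW].
Qed.

End Bracket.

Arguments bracket_stable {R n} K U.

(** * Coordinates, the adjoint representation and the Killing form *)

Section Coordinates.
Variables (R : realType) (n : nat) (g : {vspace 'M[R]_n}).
Implicit Types x y z : 'M[R]_n.
Local Notation d := (\dim g).
Local Notation b := (vbasis g).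
Local Notation ad := (ad_mx g).

Definition coords x : 'rV[R]_d := \row_j coord b j x.
Definition of_coords (v : 'rV[R]_d) : 'M[R]_n := \sum_j v 0 j *: b`_j.

Lemma coords_sum (I : finType) (f : I -> 'M[R]_n) :
  coords (\sum_i f i) = \sum_i coords (f i).
Proof.
by apply/rowP => j; rewrite mxE linear_sum summxE; apply: eq_bigr => i _; rewrite mxE.
Qed.

Lemma coordsD x y : coords (x + y) = coords x + coords y.
Proof. by apply/rowP => j; rewrite !mxE linearD. Qed.

Lemma coordsZ a x : coords (a *: x) = a *: coords x.
Proof. by apply/rowP => j; rewrite !mxE linearZ. Qed.

Lemma coordsN x : coords (- x) = - coords x.
Proof. by rewrite -scaleN1r coordsZ scaleN1r. Qed.

Lemma coords0 : coords 0 = 0.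
Proof. by rewrite -(scale0r (0 : 'M[R]_n)) coordsZ scale0r. Qed.

Lemma basis_mem (j : 'I_d) : b`_j \in g.
Proof. by rewrite vbasis_mem // mem_nth // size_tuple. Qed.

Lemma coordsK x : x \in g -> of_coords (coords x) = x.
Proof.
move=> xg; rewrite [RHS](coord_vbasis xg); apply: eq_bigr => j _.
by rewrite mxE.
Qed.

Lemma of_coords_mem v : of_coords v \in g.
Proof. by apply: memv_suml => j _; rewrite memvZ ?basis_mem. Qed.

Lemma of_coordsK v : coords (of_coords v) = v.
Proof.
apply/rowP => j; rewrite mxE /of_coords.
by rewrite coord_sum_free // (basis_free (vbasisP g)).
Qed.

Lemma coords_inj x y : x \in g -> y \in g -> coords x = coords y -> x = y.
Proof. by move=> xg yg e; rewrite -(coordsK _ xg) e coordsK. Qed.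

Lemma row_ad_mx x j : row j (ad x) = coords (bracket x b`_j).
Proof. by apply/rowP => k; rewrite !mxE. Qed.

Lemma coords_bracket x y : y \in g -> coords (bracket x y) = coords y *m ad x.
Proof.
move=> yg; rewrite -{1}(coordsK _ yg) bracket_sumr coords_sum mulmx_sum_row.
by apply: eq_bigr => j _; rewrite bracketZr coordsZ row_ad_mx.
Qed.

Lemma ad_mxD x y : ad (x + y) = ad x + ad y.
Proof. by apply/row_matrixP => j; rewrite linearD /= !row_ad_mx bracketDl coordsD. Qed.

Lemma ad_mxZ a x : ad (a *: x) = a *: ad x.
Proof. by apply/row_matrixP => j; rewrite linearZ /= !row_ad_mx bracketZl coordsZ. Qed.

Lemma ad_mx0 : ad 0 = 0.
Proof. by rewrite -(scale0r (0 : 'M[R]_n)) ad_mxZ scale0r. Qed.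

Lemma ad_mxN x : ad (- x) = - ad x.
Proof. by rewrite -scaleN1r ad_mxZ scaleN1r. Qed.

Lemma row_ad_coords x : x \in g ->
  row_ad (fun i => ad b`_i) (coords x) = ad x.
Proof.
move=> xg; rewrite -[in RHS](coordsK _ xg) /row_ad.
rewrite (big_morph ad ad_mxD ad_mx0).
by apply: eq_bigr => i _; rewrite ad_mxZ.
Qed.

Hypothesis gsub : lie_subalgebra g.

Lemma ad_mx_bracket x y : x \in g -> y \in g ->
  ad (bracket x y) = ad y *m ad x - ad x *m ad y.
Proof.
move=> xg yg; apply/row_matrixP => j; rewrite row_ad_mx jacobi [RHS]linearB /=.
rewrite coordsD coordsN !row_mul !row_ad_mx.
by rewrite !coords_bracket ?gsub ?basis_mem.
Qed.

Definition killing x y : R := \tr (ad x *m ad y).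

Lemma killing_invariant x y z : x \in g -> y \in g -> z \in g ->
  killing (bracket x y) z = killing x (bracket y z).
Proof.
move=> xg yg zg; rewrite /killing !ad_mx_bracket // mulmxBl mulmxBr !linearB /=.
by rewrite -mulmxA mxtrace_mulC !mulmxA.
Qed.

Lemma killingC x y : killing x y = killing y x.
Proof. exact: mxtrace_mulC. Qed.

Lemma killingDl x y z : killing (x + y) z = killing x z + killing y z.
Proof. by rewrite /killing ad_mxD mulmxDl linearD. Qed.

Lemma killingZl a x y : killing (a *: x) y = a * killing x y.
Proof. by rewrite /killing ad_mxZ -scalemxAl linearZ. Qed.

Definition gram : 'M[R]_d := \matrix_(i, j) killing b`_i b`_j.

Lemma killing_gram x y : x \in g -> y \in g ->
  killing x y = (coords x *m gram *m (coords y)^T) 0 0.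
Proof.
move=> xg yg; rewrite -{1}(coordsK _ xg) -{1}(coordsK _ yg) /of_coords.
rewrite (big_morph (fun x => killing x _) (fun x y => killingDl x y _)
   (_ : killing 0 _ = 0)); last by rewrite /killing ad_mx0 mul0mx linear0.
rewrite -mulmxA mxE; apply: eq_bigr => i _; rewrite killingZl; congr (_ * _).
rewrite mxE killingC.
rewrite (big_morph (fun x => killing x _) (fun x y => killingDl x y _)
   (_ : killing 0 _ = 0)); last by rewrite /killing ad_mx0 mul0mx linear0.
by apply: eq_bigr => j _; rewrite killingZl killingC !mxE mulrC.
Qed.

Lemma row_lie_complex :
  row_lie (fun i => ad_mxC g b`_i).
Proof.
rewrite /ad_mxC; apply: row_lie_of_basis => i j.
  rewrite -!map_row !row_ad_mx bracketC coordsN.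
  by rewrite map_mxN.
rewrite -map_row row_ad_mx.
transitivity (map_mx (real_complex R) (ad (bracket b`_i b`_j))).
  rewrite -row_ad_coords ?gsub ?basis_mem // /row_ad map_mx_sum.
  by apply: eq_bigr => k _; rewrite map_mxZ mxE.
by rewrite ad_mx_bracket ?basis_mem // map_mxB !map_mxM.
Qed.

End Coordinates.

Arguments coords {R n} g x.
Arguments of_coords {R n} g v.
Arguments killing {R n} g x y.
Arguments gram {R n} g.

Lemma map_mx_exp (F K : fieldType) (f : {rmorphism F -> K}) (n : nat)
    (A : 'M[F]_n) k : map_mx f (A ^+ k) = map_mx f A ^+ k.
Proof.
elim: k => [|k IHk]; first exact: map_mx1.
by rewrite !exprS map_mxM IHk.
Qed.

Section Simple.
Variables (R : realType) (n : nat) (g : {vspace 'M[R]_n}).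
Hypothesis gsimple : simple_lie_algebra g.
Let gsub : lie_subalgebra g := sla_bracket gsimple.
Local Notation ad := (ad_mx g).
Local Notation b := (vbasis g).
Local Notation d := (\dim g).

(** The sums of brackets form a nonzero ideal. *)
Lemma perfect z : z \in g ->
  exists u : 'I_d -> 'M[R]_n, (forall i, u i \in g) /\
    z = \sum_(i < d) bracket b`_i (u i).
Proof.
pose P z := exists u : 'I_d -> 'M[R]_n, (forall i, u i \in g) /\
    z = \sum_(i < d) bracket b`_i (u i).
have P0 : P 0.
  by exists (fun=> 0); split=> [i|]; rewrite ?mem0v // big1 // => i _; exact: bracket0r.
have Plin a u v : P u -> P v -> P (a *: u + v).
  move=> [u1 [u1g ->]] [v1 [v1g ->]]; exists (fun i => a *: u1 i + v1 i); split=> [i|].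
    by rewrite memvD ?memvZ.
  by rewrite scaler_sumr -big_split; apply: eq_bigr => i _; rewrite bracketDr bracketZr.
have [D DP] := linear_pred_vspace _ _ P P0 Plin.
have Pbr x y : x \in g -> y \in g -> P (bracket x y).
  move=> xg yg; exists (fun i => coord b i x *: y); split=> [i|]; first exact: memvZ.
  rewrite {1}(coord_vbasis xg) bracket_suml; apply: eq_bigr => i _.
  by rewrite bracketZl bracketZr.
have [] := @sla_ideal _ _ _ gsimple D.
- split; first apply/subvP => x /DP[u [ug ->]].
    by apply: memv_suml => i _; rewrite gsub ?basis_mem.
  move=> x y xg /DP[u [ug ->]]; apply/DP/Pbr => //.
  by apply: memv_suml => i _; rewrite gsub ?basis_mem.
- move=> D0; have [x [y [xg yg]]] := sla_nonabelian gsimple.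
  by have /DP := Pbr x y xg yg; rewrite D0 memv0 => ->.
- by move=> Dg zg; apply/DP; rewrite Dg.
Qed.
 
(** Engel's theorem for the action of g on itself yields a nonzero u with
    [g, u] = 0; the line spanned by u is an ideal, hence equal to g, and g is
    abelian. *)
Lemma simple_not_nil :
  ~ (forall x, x \in g -> exists k, ad x ^+ k = 0).
Proof.
move=> nil.
have nilg x : x \in g -> exists k, forall y, y \in g -> iter k (bracket x) y = 0.
  move=> xg; have [k xk] := nil x xg; exists k => y yg.
  have it j : iter j (bracket x) y \in g /\
      coords g (iter j (bracket x) y) = coords g y *m ad x ^+ j.
    elim: j => [|j [jg jE]] /=; first by rewrite mulmx1.
    by split; [exact: gsub | rewrite coords_bracket // jE exprSr mulmxA].
  have [kg kE] := it k; apply: (coords_inj _ _ g) => //; first exact: mem0v.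
  rewrite kE xk mulmx0; apply/esym.
  exact: coords0.
have [x [y [xg yg xy]]] := sla_nonabelian gsimple.
have g0 : 0%VS != g.
  by apply: contraNneq xy => e; move: xg; rewrite -e memv0 => /eqP->; rewrite bracket0l.
have st0 : bracket_stable g 0%VS.
  by move=> k u _; rewrite !memv0 => /eqP->; rewrite bracket0r.
have [u [ug u0 uc]] := engel _ _ g nilg g 0%VS g (subvv g) gsub (sub0v g)
  (subvv g) g0 st0 gsub.
have [||E] := @sla_ideal _ _ _ gsimple <[u]>%VS.
- split; first by rewrite -memvE.
  move=> k v kg /vlineP[c ->]; rewrite bracketZr.
  by have := uc k kg; rewrite memv0 => /eqP->; rewrite scaler0 mem0v.
- by move=> E; move: u0; rewrite -E memv_line.
move: yg; rewrite -E => /vlineP[c yE].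
by move: xy; have := uc x xg; rewrite memv0 yE bracketZr => /eqP->; rewrite scaler0 eqxx.
Qed.

(** The radical of the Killing form is an ideal.  If it were g, the adjoint
    action would be nilpotent after extension of scalars to the complex numbers. *)
Lemma killing_nondegenerate x :
  x \in g -> (forall y, y \in g -> killing g x y = 0) -> x = 0.
Proof.
pose P x := x \in g /\ forall y, y \in g -> killing g x y = 0.
have P0 : P 0.
  by split=> [|y yg]; rewrite ?mem0v // /killing ad_mx0 mul0mx linear0.
have Plin a u v : P u -> P v -> P (a *: u + v).
  move=> [ug u0] [vg v0]; split=> [|y yg]; first by rewrite memvD ?memvZ.
  by rewrite killingDl killingZl u0 ?v0 ?mulr0 ?addr0.
have [I IP] := linear_pred_vspace _ _ P P0 Plin.
move=> xg x0; have xI : x \in I by apply/IP.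
have [|I0|Ig] := @sla_ideal _ _ _ gsimple I.
- split; first by apply/subvP => y /IP[].
  move=> y z yg /IP[zg z0]; apply/IP; split=> [|w wg]; first exact: gsub.
  rewrite bracketC -scaleN1r killingZl killing_invariant // z0 ?mulr0 //.
  exact: gsub.
- by move: xI; rewrite I0 memv0 => /eqP.
case: simple_not_nil => z zg.
have kill0 y w : y \in g -> w \in g -> killing g y w = 0.
  by rewrite -{1}Ig => /IP[_]; apply.
have [u [ug zE]] := perfect z zg.
pose A i := ad_mxC g b`_i.
have row_adC y : y \in g ->
    row_ad A (map_mx (real_complex R) (coords g y)) = ad_mxC g y.
  move=> yg; rewrite /ad_mxC -(row_ad_coords _ _ g y yg) /row_ad map_mx_sum.
  by apply: eq_bigr => i _; rewrite map_mxZ mxE.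
have [||k] := ad_nilpotent_of_killing_eq0 _ _ A
  (map_mx (real_complex R) (coords g z))
  (fun i => map_mx (real_complex R) (coords g (u i))) (row_lie_complex _ _ g gsub).
- move=> v w; rewrite /row_ad mulmx_suml linear_sum big1 // => i _ /=.
  rewrite mulmx_sumr linear_sum big1 // => j _ /=.
  rewrite -scalemxAl -scalemxAr !linearZ /= /A /ad_mxC -map_mxM trace_map_mx.
  by have := kill0 b`_i b`_j (basis_mem _ _ _ _) (basis_mem _ _ _ _);
     rewrite /killing => ->; rewrite rmorph0 !mulr0.
- rewrite zE coords_sum map_mx_sum; apply: eq_bigr => i _.
  by rewrite coords_bracket // map_mxM.
rewrite row_adC // /ad_mxC -map_mx_exp => zk; exists k.
by apply: (map_mx_inj (f := real_complex R)); rewrite zk map_mx0.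
Qed.

End Simple.

(** * The Jacobson-Morozov theorem *)

Section JacobsonMorozov.
Variables (R : realType) (n : nat) (g : {vspace 'M[R]_n}).
Hypothesis gsimple : simple_lie_algebra g.
Let gsub : lie_subalgebra g := sla_bracket gsimple.
Local Notation ad := (ad_mx g).
Local Notation kf := (killing g).
Local Notation crd := (coords g).
Local Notation uncrd := (of_coords g).

Lemma gram_unit : gram g \in unitmx.
Proof.
rewrite -row_free_unit -kermx_eq0; apply/eqP/row_matrixP => i; rewrite row0.
set v := row i _.
have vK : v *m gram g = 0 by rewrite -row_mul mulmx_ker row0.
rewrite -(of_coordsK _ _ g v).
rewrite (killing_nondegenerate _ _ g gsimple (uncrd v)) ?coords0 //.
  exact: of_coords_mem.
move=> y yg; rewrite killing_gram ?of_coords_mem // of_coordsK vK mul0mx.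
by rewrite mxE.
Qed.

(** If e were outside the image, a linear form would vanish on the image of (ad e)^2 and
    not at e;
    the Killing form represents it by an element z, invariance gives
    (ad e)^2 z = 0, and the trace of (ad e) (ad z) would be zero and nonzero. *)
Lemma nilpotent_in_ad_square (e : 'M[R]_n) k :
  e \in g -> ad e ^+ k = 0 ->
  exists2 y, y \in g & e = bracket e (bracket e y).
Proof.
move=> eg ek; set A := ad e in ek *.
have [/submxP[w wE]|] := boolP (crd e <= A *m A)%MS.
  exists (uncrd w); first exact: of_coords_mem.
  apply: (coords_inj _ _ g) => //; first by rewrite !gsub ?of_coords_mem.
  rewrite !coords_bracket ?gsub ?of_coords_mem // of_coordsK.
  by rewrite -mulmxA.
rewrite submxE => /matrix0Pn[i [j ij]]; rewrite ord1 in ij.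
set c := col j (cokermx (A *m A)).
have Ac : A *m A *m c = 0 by rewrite /c colE mulmxA mulmx_coker mul0mx.
have ec : (crd e *m c) 0 0 != 0 by rewrite /c colE mulmxA -colE mxE.
(* The element whose pairing with y is the linear form c. *)
pose z := uncrd (invmx (gram g) *m c)^T.
have zg : z \in g by exact: of_coords_mem.
have kz y : y \in g -> kf y z = (crd y *m c) 0 0.
  move=> yg; rewrite killing_gram // /z of_coordsK trmxK !mulmxA.
  by rewrite mulmxK ?gram_unit.
have invl x y w : x \in g -> y \in g -> w \in g ->
    kf (bracket x y) w = - kf y (bracket x w).
  move=> xg yg wg; rewrite bracketC -scaleN1r killingZl mulN1r.
  by rewrite killing_invariant.
have eez : bracket e (bracket e z) = 0.
  apply: (killing_nondegenerate _ _ g gsimple); first by rewrite !gsub.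
  move=> y yg; rewrite killingC -[kf _ _]opprK -invl ?gsub //.
  rewrite -[kf _ _]opprK -invl ?gsub // opprK kz ?gsub //.
  rewrite !coords_bracket ?gsub // -[_ *m _ *m c]mulmxA -[_ *m _ *m (_ *m c)]mulmxA.
  by rewrite [_ *m (_ *m c)]mulmxA Ac mulmx0 mxE.
suff : kf e z = 0 by rewrite kz // => ec0; rewrite ec0 eqxx in ec.
have comm : A *m (A *m ad z - ad z *m A) = (A *m ad z - ad z *m A) *m A.
  have := ad_mx_bracket _ _ g gsub e (bracket e z) eg (gsub _ _ eg zg).
  rewrite eez ad_mx0 ad_mx_bracket // => /esym/eqP; rewrite subr_eq0 => /eqP.
  by rewrite -(opprB (A *m _)) mulNmx mulmxN => /oppr_inj.
pose f := real_complex R.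
have fA : map_mx f A ^+ k = 0 by rewrite -map_mx_exp ek map_mx0.
have := nilpotent_trace_mx _ _ (map_mx f A) (map_mx f (ad z)) k fA.
rewrite -!map_mxM -map_mxB -!map_mxM comm => /(_ erefl).
by rewrite trace_map_mx -[RHS](rmorph0 f) => /fmorph_inj.
Qed.

(** With e = [e, [e, y0]] and y = -2 y0, the element h = [e, y] satisfies
    [h, e] = 2e.  The element y differs from the required f by an element of the
    kernel of ad e, found by inverting ad h + 2 on [h, y] + 2y. *)
Theorem jacobson_morozov (e : 'M[R]_n) k :
  e \in g -> ad e ^+ k = 0 ->
  exists h f, [/\ h \in g, f \in g, bracket h e = e *+ 2,
    bracket h f = - (f *+ 2) & bracket e f = h].
Proof.
have memvMn x m : x \in g -> x *+ m \in g by exact: rpredMn.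
move=> eg ek; have [y0 y0g eE] := nilpotent_in_ad_square e k eg ek.
pose y := - (y0 *+ 2); pose h := bracket e y.
have yg : y \in g by rewrite memvN; exact: memvMn.
have hg : h \in g by exact: gsub.
have mul2 x : x *+ 2 = 2 *: x :> 'M[R]_n by rewrite scaler_nat.
have he : bracket h e = e *+ 2.
  by rewrite bracketC /h /y bracketNr bracketNr opprK !mul2 !bracketZr -eE.
pose s := bracket h y + y *+ 2.
have sg : s \in g by rewrite memvD ?gsub ?memvMn.
have es : bracket e s = 0.
  rewrite bracketDr mul2 bracketZr -/h.
  have -> : bracket e (bracket h y) = bracket (bracket e h) y + bracket h (bracket e y).
    by rewrite jacobi subrK.
  rewrite -/h bracketxx addr0 [bracket e h]bracketC he bracketC bracketNr opprK.
  by rewrite mul2 bracketZr [bracket y e]bracketC scalerN -/h addNr.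
have sE : crd s *m ad e = 0 by rewrite -coords_bracket // es coords0.
have EH : ad e *m ad h - ad h *m ad e = ad e *+ 2.
  by rewrite -ad_mx_bracket // he mul2 ad_mxZ scaler_nat.
have YE : ad y *m ad e - ad e *m ad y = ad h by rewrite -ad_mx_bracket.
have [w wE wH] := morozov_shift_onto_mx _ _ _ _ _ _ k EH YE ek sE.
pose z := uncrd w.
have zg : z \in g by exact: of_coords_mem.
have ez : bracket e z = 0.
  apply: (coords_inj _ _ g); rewrite ?gsub ?mem0v //.
  by rewrite coords_bracket // of_coordsK wE coords0.
have hz : bracket h z + z *+ 2 = s.
  apply: (coords_inj _ _ g) => //.
    by apply: memvD; [exact: gsub | exact: memvMn].
   by rewrite coordsD mul2 coordsZ coords_bracket // of_coordsK scaler_nat wH.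
exists h, (y - z); split=> //.
- by rewrite memvB.
- rewrite bracketDr bracketNr.
  have -> : bracket h z = s - z *+ 2 by rewrite -hz addrK.
  have -> : bracket h y = s - y *+ 2 by rewrite /s addrK.
  by rewrite mulrnBl !opprB [LHS]addrC addrA subrK.
- by rewrite bracketDr bracketNr ez subr0.
Qed.

End JacobsonMorozov.

(** * Exponentials of nilpotent matrices *)

Section NilpotentExp.
Variables (R : realType) (n : nat).
Implicit Types X y : 'M[R]_n.

Definition divided_power X k : 'M[R]_n := (k`!%:R)^-1 *: X ^+ k.

Lemma divided_powerS X k :
  X *m divided_power X k = k.+1%:R *: divided_power X k.+1.
Proof.
rewrite /divided_power scalerA factS natrM invfM mulrA mulfV ?pnatr_eq0 // mul1r.
by rewrite -scalemxAr exprS.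
Qed.

Lemma nilpotent_powers X N k : X ^+ N = 0 -> (N <= k)%N -> X ^+ k = 0.
Proof. by move=> XN /subnK <-; rewrite exprD XN mulr0. Qed.

Lemma expmx_nilpotent X N M : X ^+ N = 0 -> (N <= M)%N ->
  expmx X = \sum_(k < M) divided_power X k.
Proof.
move=> XN NM; apply: lim_near_cst; first exact: norm_hausdorff.
near=> m; rewrite /series /= -(big_mkord xpredT (divided_power X)).
have Mm : (M <= m)%N by near: m; exact: nbhs_infty_ge.
rewrite (big_cat_nat _ Mm) //= [X in _ + X](_ : _ = 0) ?addr0 //.
rewrite big_nat_cond big1 // => k; rewrite andbT => /andP[Mk _].
by rewrite (nilpotent_powers X N) ?scaler0 // (leq_trans NM).
Unshelve. all: by end_near. Qed.

(** Taylor formula: exp X y = (exp (ad X) y) exp X holds degree by degree,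
    and the series of exp (ad X) y stops at order 2. *)
Lemma divided_power_conj X y y1 y2 k :
  X *m y = y *m X + y1 -> X *m y1 = y1 *m X + y2 -> X *m y2 = y2 *m X ->
  divided_power X k.+2 *m y = y *m divided_power X k.+2 +
    y1 *m divided_power X k.+1 + 2^-1 *: (y2 *m divided_power X k).
Proof.
move=> Xy Xy1 Xy2.
have two : (2 : R) != 0 by rewrite pnatr_eq0.
have P1 : divided_power X 1 = X by rewrite /divided_power invr1 scale1r expr1.
have P0 : divided_power X 0 = 1%:M by rewrite /divided_power invr1 scale1r.
elim: k => [|k IHk].
  have P2 : divided_power X 2 = 2^-1 *: (X *m X) by rewrite /divided_power expr2.
  have XXy : X *m X *m y = y *m (X *m X) + y1 *m X + (y1 *m X + y2).
    by rewrite -mulmxA Xy mulmxDr mulmxA Xy mulmxDl Xy1 -(mulmxA y).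
  rewrite P2 P1 P0 mulmx1 -scalemxAl -scalemxAr XXy.
  move: (y *m (X *m X)) (y1 *m X) => a b.
  by apply/matrixP => i j; rewrite !mxE; field.
apply: (@scalerI _ _ (k.+3%:R)); first by rewrite pnatr_eq0.
move: (divided_powerS X k) (divided_powerS X k.+1) (divided_powerS X k.+2) IHk.
move: (divided_power X k.+3) (divided_power X k.+2) (divided_power X k.+1).
move: (divided_power X k) => p0 p3 p2 p1 E0 E1 E2 IHk.
rewrite scalemxAl -E2 -mulmxA IHk !mulmxDr -scalemxAr !mulmxA.
rewrite Xy Xy1 Xy2 !mulmxDl -!mulmxA E0 E1 E2 -!scalemxAr.
move: (y *m _) (y1 *m _) (y2 *m _) => a b c.
by apply/matrixP => i j; rewrite !mxE -(natr1 k.+2) -(natr1 k.+1); field.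
Qed.

Lemma expmx_conj X y y1 y2 N : X ^+ N = 0 ->
  bracket X y = y1 -> bracket X y1 = y2 -> bracket X y2 = 0 ->
  expmx X *m y = (y + y1 + 2^-1 *: y2) *m expmx X.
Proof.
move=> XN e1 e2 e3.
have Xy : X *m y = y *m X + y1 by rewrite -e1 /bracket addrC subrK.
have Xy1 : X *m y1 = y1 *m X + y2 by rewrite -e2 /bracket addrC subrK.
have Xy2 : X *m y2 = y2 *m X by apply/eqP; rewrite -subr_eq0 -/(bracket X y2) e3.
have P0 : divided_power X 0 = 1%:M by rewrite /divided_power invr1 scale1r.
have P1 : divided_power X 1 = X by rewrite /divided_power invr1 scale1r expr1.
have NN2 : (N <= N.+2)%N by rewrite -addn2 leq_addr.
rewrite !mulmxDl -scalemxAl.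
rewrite {1 2}(expmx_nilpotent X N N.+2) // {1}(expmx_nilpotent X N N.+1) //.
rewrite (expmx_nilpotent X N N) // !(big_ord_recl N.+1) /= !(big_ord_recl N) /=.
rewrite /bump /= !add1n P0 P1 !mulmxDl !mulmxDr !mul1mx !mulmx1.
rewrite !mulmx_suml !mulmx_sumr scaler_sumr Xy.
rewrite (eq_bigr _ (fun (i : 'I_N) _ => divided_power_conj X y y1 y2 i Xy Xy1 Xy2)).
rewrite !big_split /=.
move: (\sum_(i < N) _) (\sum_(i < N) _) (\sum_(i < N) _) => a b c.
by move: (y *m X) => yx; apply/matrixP => i j; rewrite !mxE; ring.
Qed.

Lemma Ad_expmx X y y1 y2 N : X ^+ N = 0 -> expmx X \in unitmx ->
  bracket X y = y1 -> bracket X y1 = y2 -> bracket X y2 = 0 ->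
  Ad (expmx X) y = y + y1 + 2^-1 *: y2.
Proof.
by move=> XN Xu e1 e2 e3; rewrite /Ad (expmx_conj X y y1 y2 N) // mulmxK.
Qed.

Lemma AdD (k x y : 'M[R]_n) : Ad k (x + y) = Ad k x + Ad k y.
Proof. by rewrite /Ad mulmxDr mulmxDl. Qed.

Lemma AdZ a (k x : 'M[R]_n) : Ad k (a *: x) = a *: Ad k x.
Proof. by rewrite /Ad -scalemxAr -scalemxAl. Qed.

Lemma AdM (k u x : 'M[R]_n) : k \in unitmx -> u \in unitmx ->
  Ad (k *m u) x = Ad k (Ad u x).
Proof.
move=> ku uu; have kuu : k *m u \in unitmx by rewrite unitmx_mul ku.
have inv : invmx (k *m u) = invmx u *m invmx k.
  apply: (can_inj (mulKmx kuu)).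
  by rewrite mulmxV // -mulmxA (mulmxA u) mulmxV // mul1mx mulmxV.
by rewrite /Ad inv !mulmxA.
Qed.

Lemma Ad_exp k X m : k \in unitmx -> (Ad k X) ^+ m = Ad k (X ^+ m).
Proof.
move=> ku; elim: m => [|m IHm]; first by rewrite /Ad mulmx1 mulmxV.
by rewrite !exprS IHm /Ad -![_ * _]/(_ *m _) !mulmxA mulmxKV.
Qed.

Lemma expmx_Ad k X N : k \in unitmx -> X ^+ N = 0 ->
  expmx (Ad k X) = Ad k (expmx X).
Proof.
move=> ku XN; have AN : (Ad k X) ^+ N = 0.
  by rewrite Ad_exp // XN /Ad mulmx0 mul0mx.
rewrite (expmx_nilpotent _ N N) // (expmx_nilpotent X N N) //.
rewrite [Ad k (\sum_(_ < _) _)]/Ad mulmx_sumr mulmx_suml; apply: eq_bigr => i _.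
by rewrite /divided_power Ad_exp // -AdZ.
Qed.

Lemma nilpotentZ a X N : X ^+ N = 0 -> (a *: X) ^+ N = 0.
Proof.
move=> XN; have -> : (a *: X) ^+ N = a ^+ N *: X ^+ N; last by rewrite XN scaler0.
elim: (N) => [|m IHm]; first by rewrite scale1r.
by rewrite exprS IHm -[LHS]/(_ *m _) -scalemxAl -scalemxAr scalerA -exprS -[X *m _]exprS.
Qed.

End NilpotentExp.

(** The point Ad k e stays in g because exp (t k e k^-1) = k exp (t e) k^-1;
    the curve moved by Ad k is polynomial in t and passes through Ad k e at t = 0. *)
Lemma limit_orbits_of_curve (R : realType) (n : nat) (G : set 'M[R]_n)
    (g : {vspace 'M[R]_n}) (e x a b : 'M[R]_n) (N : nat) :
  linear_lie_group G -> is_lie_algebra_of g G -> e \in g -> e ^+ N = 0 ->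
  (forall t : R, 0 < t -> exists2 u, G u &
     Ad u (t ^+ 2 *: x) = e + t *: a + t ^+ 2 *: b) ->
  adjoint_orbit G e `<=` limit_orbits G g x.
Proof.
move=> GG gG eg eN curve _ [k Gk <-] eps /= eps0.
have ku := llg_unit GG Gk; split.
  apply/gG => t; rewrite -AdZ (expmx_Ad _ _ _ _ N) ?nilpotentZ //.
  apply: (llg_mul GG); last exact: llg_inv.
  by apply: (llg_mul GG) => //; apply: (gG e).1.
move=> B Bnbhs.
pose phi t := Ad k e + t *: Ad k a + t ^+ 2 *: Ad k b.
have phi0 : phi t @[t --> 0^'+] --> Ad k e.
  have id0 : (t : R) @[t --> 0^'+] --> (0 : R) by exact: cvg_at_right_filter.
  have sq0 : (t : R) ^+ 2 @[t --> 0^'+] --> (0 : R).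
    have h := cvgM id0 id0; rewrite mulr0 in h; exact: h.
  have -> : Ad k e = Ad k e + 0 *: Ad k a + 0 *: Ad k b by rewrite !scale0r !addr0.
  apply: cvgD; last exact: cvgZr_tmp.
  by apply: cvgD; [exact: cvg_cst | exact: cvgZr_tmp].
have : \forall t \near 0^'+, B (phi t) /\ 0 < t /\ t < Num.min 1 eps.
  near=> t; split; last split.
  - near: t; exact: phi0.
  - near: t; exact: nbhs_right_gt.
  - near: t; apply: nbhs_right_lt; by rewrite lt_min ltr01.
case/filter_ex => t [Bt [t0 t1]]; exists (phi t); split=> //.
move: t1; rewrite lt_min => /andP[t1 teps].
exists (t ^+ 2) => /=.
  rewrite exprn_gt0 //= (le_lt_trans _ teps) // expr2 ler_piMl // ltW //.
have [u Gu uE] := curve t t0; exists (k *m u); first exact: llg_mul.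
by rewrite AdM ?(llg_unit GG) // uE !AdD !AdZ.
Unshelve. all: by end_near. Qed.

(** * Hyperbolic and elliptic elements of an sl2-triple *)

Section Triple.
Variables (R : realType) (n : nat) (g : {vspace 'M[R]_n}) (h e f : 'M[R]_n).
Hypothesis gsub : lie_subalgebra g.
Hypotheses (hg : h \in g) (eg : e \in g) (fg : f \in g).
Hypotheses (he : bracket h e = e *+ 2) (hf : bracket h f = - (f *+ 2))
  (ef : bracket e f = h).

Lemma ad_sl2_triple : sl2_triple (ad_mxC g f) (ad_mxC g e) (ad_mxC g h).
Proof.
have adr x y : x \in g -> y \in g ->
    ad_mxC g x * ad_mxC g y - ad_mxC g y * ad_mxC g x = ad_mxC g (bracket y x).
  by move=> xg yg; rewrite /ad_mxC ad_mx_bracket // map_mxB !map_mxM.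
have ad2 x : ad_mxC g (x *+ 2) = ad_mxC g x *+ 2.
  by rewrite /ad_mxC -scaler_nat ad_mxZ scaler_nat raddfMn.
have adN x : ad_mxC g (- x) = - ad_mxC g x by rewrite /ad_mxC ad_mxN map_mxN.
split; rewrite adr //.
- by rewrite bracketC hf opprK ad2.
- by rewrite bracketC he adN ad2.
- by rewrite ef.
Qed.

Lemma triple_hyperbolic : hyperbolic_elt g h.
Proof.
have [dh eh] := sl2_semisimple _ _ _ _ _ ad_sl2_triple.
by split=> // a /eh[z ->]; rewrite -(rmorph_int (real_complex R)).
Qed.

(** Over the complex numbers i (e - f) acts like the middle element of an
    sl2-triple, with integer eigenvalues. *)
Lemma triple_elliptic : elliptic_elt g (e - f).
Proof.
have i2 : ('i%C : R[i]) ^+ 2 = -1 by exact: sqr_i.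
have := sl2_semisimple _ _ _ _ _ (cayley_triple _ _ _ _ _ _ i2 ad_sl2_triple).
have -> : ad_mxC g e - ad_mxC g f = ad_mxC g (e - f).
  by rewrite /ad_mxC ad_mxD ad_mxN map_mxD map_mxN.
set T := ad_mxC g (e - f) => -[dT eT].
have TE : T = - 'i%C *: ('i%C *: T) by rewrite scalerA mulNr -expr2 i2 opprK scale1r.
split; first by split; [rewrite memvB | rewrite -/T TE; exact: diagonalizableZ].
move=> a /(eigenvalueZ _ _ 'i%C) /eT[z iz].
have -> : a = - (z%:~R * 'i%C).
  by rewrite -iz mulrAC -expr2 i2 mulN1r opprK.
by rewrite raddfN /= ReiNIm -(rmorph_int (real_complex R)) /= oppr0 oppr0.
Qed.

End Triple.

(** * Limits of adjoint orbits *)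

Theorem proposition3p7 (R : realType) (n : nat) (G : set 'M[R]_n)
    (g : {vspace 'M[R]_n}) (e : 'M[R]_n)
    (hG : connected_simple_linear_lie_group G g)
    (he : nilpotent_elt g e) :
  exists x_h x_e : 'M[R]_n,
    [/\ hyperbolic_elt g x_h,
        elliptic_elt g x_e,
        adjoint_orbit G e `<=` limit_orbits G g x_h
      & adjoint_orbit G e `<=` limit_orbits G g x_e].
Proof.
have [GG _ gG gsimple] := hG; have [eg [k ek]] := he.
have gsub := sla_bracket gsimple.
have [h [f [hg fg bhe bhf bef]]] := jacobson_morozov _ _ g gsimple e k eg ek.
have [N eN] := ladder_nilpotent_mx _ _ e h bhe.
have bh : bracket e h = - (e *+ 2) by rewrite bracketC bhe.
have Gexp s : G (expmx (s *: e)) by apply: (gG e).1.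
have uexp s : expmx (s *: e) \in unitmx by apply: (llg_unit GG).
have mul2 (x : 'M[R]_n) : x *+ 2 = 2 *: x by rewrite scaler_nat.
exists h, (e - f); split.
- exact: (triple_hyperbolic _ _ g h e f).
- exact: (triple_elliptic _ _ g h e f).
- apply: (limit_orbits_of_curve _ _ _ _ _ _ 0 h N GG gG eg eN) => t t0.
  (* Here nu = t^2 and s = - 1 / (2 nu), so that -2 s nu = 1. *)
  exists (expmx (- (2 * t ^+ 2)^-1 *: e)) => //.
  rewrite AdZ (Ad_expmx _ _ _ h (((t ^+ 2)^-1) *: e) 0 N); last first.
  + exact: bracket0r.
  + by rewrite bracketZl bracketZr bracketxx !scaler0.
  + rewrite bracketZl bh mul2 scalerN scaleNr opprK scalerA.
    by congr (_ *: _); field; rewrite gt_eqF.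
  + exact: uexp.
  + exact: nilpotentZ.
  rewrite scaler0 addr0 scaler0 addr0 scalerDr addrC scalerA mulfV ?scale1r //.
  by rewrite expf_neq0 // gt_eqF.
- apply: (limit_orbits_of_curve _ _ _ _ _ _ (- h) (e - f) N GG gG eg eN) => t t0.
  have tn0 : t != 0 by rewrite gt_eqF.
  (* Here s = 1 / t and nu = t^2 = 1 / s^2. *)
  exists (expmx (t^-1 *: e)) => //.
  rewrite AdZ (Ad_expmx _ _ _ (e - f) (- (t^-1 *: h)) ((2 * t^-1 ^+ 2) *: e) N); last first.
  + by rewrite bracketZl bracketZr bracketxx !scaler0.
  + rewrite bracketZl bracketNr bracketZr bh mul2 !scalerN opprK !scalerA.
    by congr (_ *: _); ring.
  + by rewrite bracketZl bracketDr bracketNr bracketxx bef add0r scalerN.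
  + exact: uexp.
  + exact: nilpotentZ.
  by apply/matrixP => i j; rewrite !mxE; field.
Qed.
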